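(* Let $p,n,s\in\mathbb{N}$ with $1 \leq s \leq p$. Suppose $\kappa > 0$ and $\log\left(1+\frac{p}{s^2}\right) \geq \kappa n$. If $\eta \in (0,1)$, then for any $0 < c < 1 \wedge \sqrt{\kappa} \wedge \sqrt{\kappa \log(1+4\eta^2)}$ we have $$\inf_{\varphi}\left\{ P_0\{\varphi \neq 0\} + \sup_{\substack{f \in \mathcal{F}_s, \\ \|f\|_2 \geq c\sqrt{s}}} P_f\{\varphi \neq 1\}\right\} \geq 1-\eta.$$
   Context: Notation: $[p]=\{1,\dots,p\}$, $a\wedge b=\min\{a,b\}$. Model: one observes the $p$-dimensional Gaussian white noise model $dY_x = f(x)\,dx + \frac{1}{\sqrt n}\,dB_x$, $x\in[0,1]^p$. $P_f$ denotes the law of the observation when the signal is $f$, and $P_0$ the law when $f\equiv 0$. The infimum is over all tests $\varphi$, i.e. measurable functions of the observation with values in $\{0,1\}$. $\|\cdot\|_2$ is the $L^2([0,1]^p)$ norm. Function space: $\mathcal{H}\subset L^2([0,1])$ is a reproducing kernel Hilbert space (RKHS) whose kernel admits a Mercer expansion. Let $\mathbf 1$ be the constant function one and $\mathcal{H}_0 := \mathcal{H}\cap \mathrm{span}\{\mathbf 1\}^\perp$ (orthogonality in $L^2([0,1])$), also an RKHS, with eigenfunctions $\{\psi_k\}_{k\ge1}$ orthonormal in $L^2([0,1])$ and corresponding eigenvalues $\mu_1\ge\mu_2\ge\dots\ge0$ in the Mercer expansion of its kernel, so that $\|g\|_{\mathcal{H}_0}^2=\sum_{k\ge1}\mu_k^{-1}\langle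 g,\psi_k\rangle_{L^2}^2$. It is assumed that $\mu_1=1$. Parameter space: for $S\subset[p]$, $\mathcal{H}_S := \{f(x)=\sum_{j\in S} f_j(x_j): f_j\in\mathcal{H}_0,\ \|f_j\|_{\mathcal{H}_0}\le 1 \text{ for all } j\in S\}$, and $\mathcal{F}_s := \bigcup_{S\subset[p],\,|S|\le s}\mathcal{H}_S$. *)

(* Defs.v *)
From HB Require Import structures.
From mathcomp Require Import all_boot all_order all_algebra.
From mathcomp Require Import all_classical all_reals all_analysis.

Set Implicit Arguments.
Unset Strict Implicit.
Unset Printing Implicit Defensive.

Import Order.TTheory GRing.Theory Num.Theory.
Import numFieldNormedType.Exports.

Local Open Scope classical_set_scope.
Local Open Scope ring_scope.

Definition tcons (T : Type) (n : nat) (xt : T * n.-tuple T) : n.+1.-tuple T :=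
  [the n.+1.-tuple T of xt.1 :: xt.2].

Lemma measurable_tcons (R : realType) (n : nat) :
  measurable_fun setT (@tcons (measurableTypeR R) n).
Proof. by apply: measurable_cons => //; apply: measurable_snd. Qed.

Lemma sigma_finite_product d1 d2 (T1 : measurableType d1)
    (T2 : measurableType d2) (R : realType)
    (m1 : {sigma_finite_measure set T1 -> \bar R})
    (m2 : {sigma_finite_measure set T2 -> \bar R}) :
  sigma_finite setT (m1 \x m2)%E.
Proof.
have /sigma_finiteP[F [TF ndF Foo]] := sigma_finiteT m1.
have /sigma_finiteP[G [TG ndG Goo]] := sigma_finiteT m2.
exists (fun n => F n `*` G n).
  rewrite -setXTT TF TG predeqE => -[x y]; split.
    move=> [/= [n _ Fnx] [k _ Gky]]; exists (maxn n k) => //; split.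
    - by move: x Fnx; exact/subsetPset/ndF/leq_maxl.
    - by move: y Gky; exact/subsetPset/ndG/leq_maxr.
  by move=> [n _ []/= ? ?]; split; exists n.
move=> k; have [? ?] := Foo k; have [? ?] := Goo k.
split; first exact: measurableX.
by rewrite product_measure1E// lte_mul_pinfty// ge0_fin_numE.
Qed.

Section lebesgue_cons.
Context (R : realType) (n : nat).
Context (m : {sigma_finite_measure set (n.-tuple (measurableTypeR R)) -> \bar R}).

Definition lebesgue_cons : set (n.+1.-tuple (measurableTypeR R)) -> \bar R :=
  pushforward (lebesgue_measure \x m)%E (@tcons (measurableTypeR R) n).

Let mtcons := @measurable_tcons R n.

Let lebesgue_cons0 : lebesgue_cons set0 = 0%E.
Proof. by rewrite /lebesgue_cons; exact: measure0. Qed.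

Let lebesgue_cons_ge0 A : (0 <= lebesgue_cons A)%E.
Proof. by rewrite /lebesgue_cons; exact: measure_ge0. Qed.

Let lebesgue_cons_sigma_additive : semi_sigma_additive lebesgue_cons.
Proof. by rewrite /lebesgue_cons; exact: measure_semi_sigma_additive. Qed.

HB.instance Definition _ := isMeasure.Build _ _ _ lebesgue_cons
  lebesgue_cons0 lebesgue_cons_ge0 lebesgue_cons_sigma_additive.

Let lebesgue_cons_sigma_finite : sigma_finite setT lebesgue_cons.
Proof.
have [F FT FP] := sigma_finite_product lebesgue_measure m.
pose g (t : n.+1.-tuple (measurableTypeR R)) :
    (measurableTypeR R * n.-tuple (measurableTypeR R))%type :=
  (tnth t ord0, [tuple of behead t]).
have mg : measurable_fun setT g.
  apply/measurable_fun_pairP; split.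
    exact: (measurable_tnth (T := measurableTypeR R) (ord0 : 'I_n.+1)).
  exact: measurable_behead.
have gK x : g (tcons x) = x.
  by case: x => x t; rewrite /g /tcons /=; congr pair; exact/val_inj.
exists (fun i => g @^-1` F i); first by rewrite -preimage_bigcup -FT preimage_setT.
move=> i; have [mFi Fi] := FP i; split.
  by rewrite -[X in measurable X]setTI; exact: mg.
rewrite /lebesgue_cons /pushforward -comp_preimage (_ : g \o _ = id)//.
by apply/funext => x /=; exact: gK.
Qed.

HB.instance Definition _ := @Measure_isSigmaFinite.Build _ _ _ lebesgue_cons
  lebesgue_cons_sigma_finite.

End lebesgue_cons.

(* Lebesgue measure on R^n, the iterated product of the one-dimensional one. *)
Fixpoint lebesgue_tuple (R : realType) (n : nat) :
    {sigma_finite_measure set (n.-tuple (measurableTypeR R)) -> \bar R} :=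
  match n with
  | 0 => dirac [tuple]
  | m.+1 => lebesgue_cons (lebesgue_tuple R m)
  end.

Definition L2unit (R : realType) : set (R -> R) :=
  [set g : R -> R | measurable_fun (`[0, 1] : set R) g /\
     lebesgue_measure.-integrable `[0, 1] (fun x => (g x ^+ 2)%:E)].

Definition L2unit_ip (R : realType) (g h : R -> R) : R :=
  (\int[lebesgue_measure]_(x in `[0, 1]) (g x * h x))%R.

(* A real Hilbert space H of functions on [0, 1], with inner product ip and
   reproducing kernel K.  A function on [0, 1] is represented by any function
   on R that extends it, so the zero vectors of H are the members of H
   vanishing on [0, 1]. *)
Record is_rkhs (R : realType) (H : set (R -> R))
    (ip : (R -> R) -> (R -> R) -> R) (K : R -> R -> R) : Prop := {
  rkhs_zero : H (fun=> 0);
  rkhs_linear : forall a g h, H g -> H h -> H (fun x => a * g x + h x);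
  rkhs_ip_sym : forall g h, H g -> H h -> ip g h = ip h g;
  rkhs_ip_linear : forall a g h k, H g -> H h -> H k ->
    ip (fun x => a * g x + h x) k = a * ip g k + ip h k;
  rkhs_ip_ge0 : forall g, H g -> 0 <= ip g g;
  rkhs_ip_eq0 : forall g, H g ->
    (ip g g = 0 <-> {in `[0, 1], forall x, g x = 0});
  rkhs_complete : forall u : nat -> R -> R, (forall i, H (u i)) ->
    (forall e, 0 < e -> exists N, forall i j, (N <= i)%N -> (N <= j)%N ->
       ip (u i \- u j) (u i \- u j) < e) ->
    exists2 g, H g & (fun i => ip (u i \- g) (u i \- g)) @ \oo --> (0 : R);
  rkhs_kernel : {in `[0, 1], forall x, H (K x)};
  rkhs_reproducing : forall g, H g ->
    {in `[0, 1], forall x, ip g (K x) = g x} }.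

Definition rkhs_norm (R : realType) (ip : (R -> R) -> (R -> R) -> R)
  (g : R -> R) : R := Num.sqrt (ip g g).

(* Eigenvalues and eigenfunctions are numbered from 0, so that mu 0 is the
   largest eigenvalue. *)
Record mercer_expansion (R : realType) (K : R -> R -> R) (mu : nat -> R)
    (psi : nat -> R -> R) : Prop := {
  mercer_L2 : forall k, L2unit (psi k);
  mercer_orthonormal : forall j k, L2unit_ip (psi j) (psi k) = (j == k)%:R;
  mercer_ge0 : forall k, 0 <= mu k;
  mercer_nonincreasing : forall k, mu k.+1 <= mu k;
  mercer_sum : {in `[0, 1] &, forall x y,
    series (fun k => mu k * psi k x * psi k y) @ \oo --> K x y} }.

Definition centered (R : realType) (H : set (R -> R)) : set (R -> R) :=
  [set g | H g /\ L2unit_ip g (fun=> 1) = 0].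

Definition cube (R : realType) (p : nat) : set (p.-tuple (measurableTypeR R)) :=
  [set x | forall i, 0 <= (tnth x i : R) <= 1].

Definition cube_L2norm (R : realType) (p : nat)
    (f : p.-tuple (measurableTypeR R) -> R) : \bar R :=
  Lnorm (lebesgue_tuple R p) 2%:E (EFin \o (f \_ (@cube R p))).

Definition additive_ball (R : realType) (p : nat) (H0 : set (R -> R))
    (ip : (R -> R) -> (R -> R) -> R) (S : {set 'I_p}) :
    set (p.-tuple (measurableTypeR R) -> R) :=
  [set f | exists2 g : 'I_p -> R -> R,
     forall j, j \in S -> H0 (g j) /\ rkhs_norm ip (g j) <= 1 &
     forall x, cube x -> f x = \sum_(j in S) g j (tnth x j)].

Definition sparse_additive (R : realType) (p : nat) (H0 : set (R -> R))
    (ip : (R -> R) -> (R -> R) -> R) (s : nat) :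
    set (p.-tuple (measurableTypeR R) -> R) :=
  [set f | exists2 S : {set 'I_p}, (#|S| <= s)%N & additive_ball H0 ip S f].

Definition is_box (R : realType) (p : nat)
    (a b : p.-tuple (measurableTypeR R)) : Prop :=
  forall i, [/\ 0 <= (tnth a i : R), (tnth a i : R) < tnth b i
              & (tnth b i : R) <= 1].

Definition box (R : realType) (p : nat) (a b : p.-tuple (measurableTypeR R)) :
    set (p.-tuple (measurableTypeR R)) :=
  [set x | forall i, (tnth a i : R) < tnth x i <= tnth b i].

Definition box_volume (R : realType) (p : nat)
    (a b : p.-tuple (measurableTypeR R)) : R :=
  \prod_(i < p) ((tnth b i : R) - tnth a i).

(* Increment over the box ]a, b] of a function F on the cube: the alternating
   sum of F over the vertices of the box. *)
Definition box_increment (R : realType) (p : nat)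
    (F : p.-tuple (measurableTypeR R) -> R)
    (a b : p.-tuple (measurableTypeR R)) : R :=
  \sum_(S : {set 'I_p}) (-1) ^+ #|~: S| *
    F [tuple if i \in S then tnth b i else tnth a i | i < p].

(* Standard Brownian sheet on [0, 1]^p: it vanishes on the coordinate
   hyperplanes, its increment over ]a, b] has law N(0, volume of ]a, b]), and
   its increments over pairwise disjoint boxes are mutually independent.
   Equivalently, a centered Gaussian process with covariance
   (x, y) |-> \prod_i min(x_i, y_i). *)
Record brownian_sheet (R : realType) (p : nat) (d : measure_display)
    (Omega : measurableType d) (P : probability Omega R)
    (B : p.-tuple (measurableTypeR R) -> Omega -> R) : Prop := {
  sheet_measurable : forall t, cube t -> measurable_fun setT (B t);
  sheet_axes : forall t, cube t -> (exists i, (tnth t i : R) = 0) ->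
    {ae P, forall w, B t w = 0};
  sheet_gaussian : forall a b, is_box a b -> forall A : set R, measurable A ->
    P [set w | A (box_increment (B ^~ w) a b)] =
    normal_prob 0 (Num.sqrt (box_volume a b)) A;
  sheet_independent : forall (m : nat)
      (a b : 'I_m -> p.-tuple (measurableTypeR R)),
    (forall k, is_box (a k) (b k)) ->
    (forall k l, k != l -> box (a k) (b k) `&` box (a l) (b l) = set0) ->
    forall A : 'I_m -> set R, (forall k, measurable (A k)) ->
    P [set w | forall k, A k (box_increment (B ^~ w) (a k) (b k))] =
    (\prod_(k < m) P [set w | A k (box_increment (B ^~ w) (a k) (b k))])%E }.

(* The space of sample paths, with the sigma-algebra generated by the
   evaluations at the points of the cube. *)
Definition path_cylinders (R : realType) (p : nat) :
    set (set (p.-tuple (measurableTypeR R) -> R)) :=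
  [set C | exists t, cube t /\
     exists2 A : set R, measurable A & C = [set y | A (y t)]].

Definition path_space (R : realType) (p : nat) : Type :=
  g_sigma_algebraType (@path_cylinders R p).

(* Integrated form of dY_x = f(x) dx + n^(-1/2) dB_x:
   Y_t is the integral of f over [0, t], plus n^(-1/2) B_t. *)
Definition white_noise (R : realType) (p n : nat) (Omega : Type)
    (B : p.-tuple (measurableTypeR R) -> Omega -> R)
    (f : p.-tuple (measurableTypeR R) -> R) (w : Omega) : path_space R p :=
  fun t => (\int[lebesgue_tuple R p]_(x in
              [set x | forall i, 0 <= (tnth x i : R) <= tnth t i]) f x)%R
           + (Num.sqrt n%:R)^-1 * B t w.

Definition white_noise_law (R : realType) (p n : nat) (d : measure_display)
    (Omega : measurableType d) (P : probability Omega R)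
    (B : p.-tuple (measurableTypeR R) -> Omega -> R)
    (f : p.-tuple (measurableTypeR R) -> R) :
    set (path_space R p) -> \bar R :=
  pushforward P (white_noise n B f).

(* Main.v *)
Require Import Defs.
From HB Require Import structures.
From mathcomp Require Import all_boot all_order all_algebra.
From mathcomp Require Import all_classical all_reals all_analysis.
From mathcomp Require Import measurable_realfun zify ring lra.

Set Implicit Arguments.
Unset Strict Implicit.
Unset Printing Implicit Defensive.

Import Order.TTheory GRing.Theory Num.Theory.
Import numFieldNormedType.Exports.

Local Open Scope classical_set_scope.
Local Open Scope ring_scope.

(** The bound is an instance of Le Cam's method with a sparse prior.  Let [h] be
the leading eigenfunction of the kernel of the centered space and, for a set
[S] of [s] coordinates, let [f_S x] be the sum over [j] in [S] of
[c * h (x_j)].  Since the leading eigenvalue is [1], [h] lies in the unit ball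
([top_eigenfunction_in_unit_ball]), so [f_S] is an admissible alternative; as
[h] has mean zero and norm one, [f_S] has norm exactly [c * sqrt s]
([cube_L2norm_signal]).  Replacing the supremum by the average over all [S],
the sum of the two errors of a test with acceptance region [C] is at least
[1 - (P_0 C - average of the P_S C)], and it remains to see that the average
probability of [C] falls short of [P_0 C] by at most [eta]
([mixture_bound]).

This is a second-moment computation.  Half the square root of the chi-square
divergence bounds the defect ([gauss_mixture_le]).  For Gaussian shifts the
second moment of the averaged likelihood ratio is the average over [S] and [T]
of the exponential of [n <f_S, f_T> = n c^2 #|S :&: T|]; cross terms vanish
because [h] is centered.  Expanding [(1 + u) ^ #|S :&: T|] over the subsets of
[S :&: T] shows that its average is at most [(1 + u s / p) ^ s]
([sum_exp_overlap]).  With [u = exp (n c^2) - 1], the assumption on [kappa n]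
makes [u] at most [(c^2 / kappa) (p / s^2)], and the average is at most
[exp (c^2 / kappa)], which is at most [1 + 4 eta^2] ([sum_exp_overlap_le]).

The laws to be compared live on a space of paths, but no density on that space
is needed.  The class of [C] for which the comparison holds is monotone, so the
monotone class theorem reduces it to events that depend on the values of the
path at finitely many points.  These points are vertices of a finite grid of
the cube.  Almost surely the path vanishes at the vertices that lie on the
coordinate hyperplanes, so its values on the grid are sums of its increments over the cells
([grid_reconstruct]), and these are independent Gaussian variables: the law is
an explicit product density ([observation_grid_law]).  The means of the
increments are those of the [f_S] averaged over the cells, an operation that
does not increase [<f_S, f_T>] ([drift_energy_le]), so the computation above
applies on every grid with the same bound. *)

(** * Membership in a reproducing kernel Hilbert space *)

Lemma cvg_ge_lim (R : realType) (u : nat -> R) (a l : R) :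
  u @ \oo --> l -> (\forall n \near \oo, a <= u n) -> a <= l.
Proof.
move=> ul au; rewrite -(cvg_lim _ ul)//; apply: limr_ge => //.
by apply/cvg_ex; exists l.
Qed.

Lemma cvg_sum_seq (R : realType) (I : eqType) (r : seq I) (f : I -> nat -> R)
    (l : I -> R) : {in r, forall i, f i @ \oo --> l i} ->
  (fun n => \sum_(i <- r) f i n) @ \oo --> \sum_(i <- r) l i.
Proof.
elim: r => [_|i r IH fl].
  rewrite big_nil (_ : (fun n => _) = fun=> 0); first exact: cvg_cst.
  by apply/funext => n; rewrite big_nil.
rewrite big_cons (_ : (fun n => _) = fun n => f i n + \sum_(j <- r) f j n).
  apply: cvgD; first by apply: fl; rewrite mem_head.
  by apply: IH => j jr; apply: fl; rewrite in_cons jr orbT.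
by apply/funext => n; rewrite big_cons.
Qed.

Section reproducing_kernel.
Context (R : realType).

Lemma discriminant_le (a b c : R) : 0 <= c ->
  (forall t, 0 <= a + 2 * t * b + t ^+ 2 * c) -> b ^+ 2 <= a * c.
Proof.
move=> c_ge0 pos; have a_ge0 : 0 <= a by have := pos 0; lra.
have [c0|c_neq0] := eqVneq c 0.
  suff -> : b = 0 by rewrite expr0n/= mulr_ge0.
  have [//|b_neq0] := eqVneq b 0.
  have := pos (- (a + 1) / (2 * b)); rewrite c0 mulr0 addr0.
  rewrite (_ : 2 * (- (a + 1) / (2 * b)) * b = - (a + 1)); first lra.
  by field.
have c_gt0 : 0 < c by rewrite lt_neqAle eq_sym c_neq0.
have := pos (- b / c).
rewrite (_ : a + _ + _ = (a * c - b ^+ 2) / c); last by field.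
by rewrite pmulr_lge0 ?invr_gt0// subr_ge0.
Qed.

Context (H : set (R -> R)) (ip : (R -> R) -> (R -> R) -> R) (K : R -> R -> R).
Context (HK : is_rkhs H ip K).

Let H0 : H (fun=> 0). Proof. exact: rkhs_zero HK. Qed.

Lemma rkhs_memZ a g : H g -> H (fun x => a * g x).
Proof.
move=> Hg; have := rkhs_linear HK a Hg H0.
by congr H; apply/funext => x; rewrite addr0.
Qed.

Lemma rkhs_memB g h : H g -> H h -> H (g \- h).
Proof.
move=> Hg Hh; have := rkhs_linear HK (-1) Hh Hg.
by congr H; apply/funext => x /=; rewrite mulN1r addrC.
Qed.

Lemma rkhs_ip0l k : H k -> ip (fun=> 0) k = 0.
Proof.
move=> Hk; have := rkhs_ip_linear HK 1 H0 H0 Hk.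
rewrite (_ : (fun x : R => 1 * 0 + 0) = fun=> 0); first lra.
by apply/funext => x; rewrite mulr0 addr0.
Qed.

Lemma rkhs_ipZl a g k : H g -> H k -> ip (fun x => a * g x) k = a * ip g k.
Proof.
move=> Hg Hk; have := rkhs_ip_linear HK a Hg H0 Hk; rewrite rkhs_ip0l// addr0.
by move=> <-; congr ip; apply/funext => x; rewrite addr0.
Qed.

Lemma rkhs_ipBl g h k : H g -> H h -> H k -> ip (g \- h) k = ip g k - ip h k.
Proof.
move=> Hg Hh Hk; have := rkhs_ip_linear HK (-1) Hh Hg Hk.
rewrite mulN1r addrC => <-; congr ip.
by apply/funext => x /=; rewrite mulN1r addrC.
Qed.

Lemma rkhs_sqrB g h : H g -> H h ->
  ip (g \- h) (g \- h) = ip g g - 2 * ip g h + ip h h.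
Proof.
move=> Hg Hh; have Hgh := rkhs_memB Hg Hh.
rewrite rkhs_ipBl// (rkhs_ip_sym HK Hg Hgh) (rkhs_ip_sym HK Hh Hgh) !rkhs_ipBl//.
by rewrite (rkhs_ip_sym HK Hh Hg); ring.
Qed.

Lemma rkhs_cauchy_schwarz g h : H g -> H h -> ip g h ^+ 2 <= ip g g * ip h h.
Proof.
move=> Hg Hh; apply: discriminant_le => [|t]; first exact: rkhs_ip_ge0 HK _ Hh.
have Hth := rkhs_memZ (- t) Hh.
have := rkhs_ip_ge0 HK (rkhs_memB Hg Hth); rewrite rkhs_sqrB//.
rewrite (rkhs_ip_sym HK Hg Hth) !rkhs_ipZl// (rkhs_ip_sym HK Hh Hth) rkhs_ipZl//.
by rewrite (rkhs_ip_sym HK Hh Hg); congr (_ <= _); ring.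
Qed.

Lemma rkhs_eval_sqr_le g x : H g -> x \in `[0, 1] -> g x ^+ 2 <= ip g g * K x x.
Proof.
move=> Hg x01; have HKx := rkhs_kernel HK x01.
rewrite -(rkhs_reproducing HK Hg x01) -(rkhs_reproducing HK HKx x01).
exact: rkhs_cauchy_schwarz.
Qed.

Let nodes (l : seq (R * R)) := all (fun u => u.2 \in `[0, 1]) l.
Let comb (l : seq (R * R)) (x : R) := \sum_(u <- l) u.1 * K u.2 x.
Let at_nodes (g : R -> R) (l : seq (R * R)) := \sum_(u <- l) u.1 * g u.2.

Let comb_mem l : nodes l -> H (comb l).
Proof.
elim: l => [_|u l IH /= /andP[u01 /IH Hl]].
  by rewrite (_ : comb [::] = fun=> 0)//; apply/funext => x; rewrite /comb big_nil.
have := rkhs_linear HK u.1 (rkhs_kernel HK u01) Hl.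
by congr H; apply/funext => x; rewrite /comb big_cons.
Qed.

Let ip_comb g l : H g -> nodes l -> ip g (comb l) = at_nodes g l.
Proof.
move=> Hg; elim: l => [_|u l IH /= /andP[u01 nl]].
  rewrite (_ : comb [::] = fun=> 0).
    by rewrite (rkhs_ip_sym HK Hg H0) rkhs_ip0l// /at_nodes big_nil.
  by apply/funext => x; rewrite /comb big_nil.
rewrite (_ : comb (u :: l) = fun x => u.1 * K u.2 x + comb l x); last first.
  by apply/funext => x; rewrite /comb big_cons.
have HKu := rkhs_kernel HK u01; have Hl := comb_mem nl.
rewrite (rkhs_ip_sym HK Hg (rkhs_linear HK _ HKu Hl)) (rkhs_ip_linear HK)//.
rewrite (rkhs_ip_sym HK HKu Hg) (rkhs_ip_sym HK Hl Hg) IH//.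
by rewrite (rkhs_reproducing HK)// /at_nodes big_cons.
Qed.

Let halves (l : seq (R * R)) := [seq (u.1 / 2, u.2) | u <- l].

Let nodes_halves l : nodes (halves l) = nodes l.
Proof. by rewrite /nodes all_map. Qed.

Let at_nodes_halves g l : at_nodes g (halves l) = at_nodes g l / 2.
Proof.
rewrite /at_nodes big_map mulr_suml; apply: eq_bigr => u _ /=.
by rewrite mulrAC.
Qed.

Let at_nodes_cat g l m : at_nodes g (l ++ m) = at_nodes g l + at_nodes g m.
Proof. by rewrite /at_nodes big_cat. Qed.

(** The hypothesis says that [K x y - g x * g y] is a positive kernel, so that
[K x |-> g x] extends to a linear functional of norm at most one on the span of
the [K x]; the lemma is the Riesz representation of that functional.  The span
is handled through lists of pairs (coefficient, node), and the representative
is the limit of a minimizing sequence of [|v|^2 - 2 L v] over the span. *)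
Lemma rkhs_mem_of_dominated (g : R -> R) :
  (forall l : seq (R * R), all (fun u => u.2 \in `[0, 1]) l ->
     (\sum_(u <- l) u.1 * g u.2) ^+ 2 <=
     \sum_(u <- l) \sum_(v <- l) u.1 * v.1 * K u.2 v.2) ->
  exists h, [/\ H h, {in `[0, 1], h =1 g} & ip h h <= 1].
Proof.
move=> g_le.
pose N l := ip (comb l) (comb l); pose L := at_nodes g.
have N_ge l : nodes l -> L l ^+ 2 <= N l.
  move=> nl; rewrite /N ip_comb//; last exact: comb_mem.
  apply: le_trans (g_le _ nl) _; rewrite le_eqVlt; apply/orP; left; apply/eqP.
  rewrite /at_nodes /comb exchange_big/=; apply: eq_bigr => u _.
  by rewrite mulr_sumr; apply: eq_bigr => v _; ring.
pose Q l := N l - 2 * L l.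
have Q_ge l : nodes l -> -1 <= Q l.
  by move=> /N_ge; rewrite /Q => ?; have := sqr_ge0 (L l - 1); nra.
pose E := [set Q l | l in [set l | nodes l]].
have lbE : has_lbound E by exists (-1) => _ [l nl <-]; exact: Q_ge.
have Ene : E !=set0 by exists (Q [::]), [::].
pose q := inf E.
have q_le l : nodes l -> q <= Q l by move=> nl; apply: ge_inf => //; exists l.
pose err (n : nat) : R := n.+1%:R^-1.
have err0 : err @ \oo --> (0 : R) by exact: cvg_harmonic.
have /choice[l lP] (n : nat) : exists l, nodes l /\ Q l <= q + err n.
  have [|_ [l nl <-] Ql] := @inf_adherent _ E (err n) _ (conj Ene lbE).
    by rewrite invr_gt0.
  by exists l; split=> //; exact: ltW.
have nl n : nodes (l n) by case: (lP n).
have Hl n : H (comb (l n)) by exact: comb_mem.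
(* Parallelogram identity: the value of [Q] at the midpoint of two almost
   minimizers is at least [q], which forces them to be close. *)
have near_le m n : ip (comb (l m) \- comb (l n)) (comb (l m) \- comb (l n)) <=
    2 * (err m + err n).
  rewrite rkhs_sqrB//; pose M := halves (l m ++ l n).
  have nM : nodes M by rewrite nodes_halves /nodes all_cat; apply/andP.
  have mid f : H f -> ip f (comb M) = (ip f (comb (l m)) + ip f (comb (l n))) / 2.
    by move=> Hf; rewrite !ip_comb// at_nodes_halves at_nodes_cat.
  have LM : L M = (L (l m) + L (l n)) / 2.
    by rewrite /L at_nodes_halves at_nodes_cat.
  have HM := comb_mem nM.
  have NM : N M = (N (l m) + N (l n) + 2 * ip (comb (l m)) (comb (l n))) / 4.
    rewrite /N mid// !(rkhs_ip_sym HK HM)// !mid// (rkhs_ip_sym HK (Hl n) (Hl m)).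
    by field.
  have := q_le _ nM; rewrite /Q NM LM.
  have [_] := lP m; have [_] := lP n; rewrite /Q /N /L.
  lra.
have [|h Hh hlim] := rkhs_complete HK (fun i => Hl i).
  move=> e e0.
  have : \forall n \near \oo, err n < e / 4.
    by have := cvgr_lt 0 err0; apply; rewrite divr_gt0.
  case=> N0 _ small; exists N0 => i j Ni Nj.
  apply: le_lt_trans (near_le i j) _.
  by have := small _ Ni; have := small _ Nj; rewrite /=; lra.
pose gap n := ip (comb (l n) \- h) (comb (l n) \- h).
have hE : {in `[0, 1], h =1 g}.
  move=> x x01; apply/eqP; rewrite -subr_eq0 -sqrf_eq0 eq_le sqr_ge0 andbT.
  have dev n : (h x - g x) ^+ 2 <= 2 * K x x * (err n + gap n).
    have to_h : (comb (l n) x - h x) ^+ 2 <= gap n * K x x.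
      exact: (rkhs_eval_sqr_le (rkhs_memB (Hl n) Hh) x01).
    have to_g : (comb (l n) x - g x) ^+ 2 <= err n * K x x.
      (* Perturbing an almost minimizer by [t * K x] cannot gain more than
         [err n], for every [t]. *)
      apply: discriminant_le => [|t].
        have HKx := rkhs_kernel HK x01.
        by rewrite -(rkhs_reproducing HK HKx x01); exact: rkhs_ip_ge0 HK _ HKx.
      have nt : nodes ((t, x) :: l n) by rewrite /= x01 nl.
      have Ht := comb_mem nt; have HKx := rkhs_kernel HK x01.
      have ipt f : H f -> ip f (comb ((t, x) :: l n)) = t * f x + ip f (comb (l n)).
        by move=> Hf; rewrite !ip_comb// /at_nodes big_cons.
      have Lt : L ((t, x) :: l n) = t * g x + L (l n) by rewrite /L /at_nodes big_cons.
      have Nt : N ((t, x) :: l n) =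
          N (l n) + 2 * t * comb (l n) x + t ^+ 2 * K x x.
        rewrite /N ipt// (rkhs_ip_sym HK Ht (Hl n)) ipt//.
        by rewrite /comb big_cons/= -/(comb (l n) x); ring.
      have := q_le _ nt; have [_] := lP n; rewrite /Q Nt Lt; lra.
    have := sqr_ge0 ((comb (l n) x - h x) + (comb (l n) x - g x)); nra.
  have : (fun n => 2 * K x x * (err n + gap n)) @ \oo --> (2 * K x x * (0 + 0)).
    by apply: cvgM; [exact: cvg_cst|exact: cvgD].
  by rewrite addr0 mulr0 => /cvg_ge_lim; apply; apply: nearW.
exists h; split=> //.
(* On the [n]-th combination, [L] is the inner product with [h], so that
   [ip h h = gap n + 2 L - N] with [L ^+ 2 <= N]. *)
have bound n : ip h h <= gap n + 1.
  have := N_ge _ (nl n); rewrite /gap rkhs_sqrB// /N.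
  rewrite (rkhs_ip_sym HK (Hl n) Hh) (ip_comb Hh (nl n)).
  rewrite (_ : at_nodes h (l n) = L (l n)); last first.
    rewrite /L /at_nodes; apply: eq_big_seq => u ul; congr (_ * _).
    by apply: hE; exact: (allP (nl n)).
  by have := sqr_ge0 (L (l n) - 1); nra.
have : (fun n => gap n + 1) @ \oo --> (0 + 1 : R) by apply: cvgD => //; exact: cvg_cst.
rewrite add0r => /cvg_ge_lim; apply; exact: nearW.
Qed.

End reproducing_kernel.

Section mercer.
Context (R : realType) (H : set (R -> R)) (ip : (R -> R) -> (R -> R) -> R)
  (K : R -> R -> R) (mu : nat -> R) (psi : nat -> R -> R)
  (HK : is_rkhs H ip K) (Kmu : mercer_expansion K mu psi).

(** Dropping all terms but the first from the expansion of [K] leaves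
[psi 0 x * psi 0 y], and what is dropped is a positive kernel.  Pointwise
convergence of the expansion is enough; the kernel is never integrated. *)
Lemma top_eigenfunction_in_unit_ball : mu 0%N = 1 ->
  exists h, [/\ H h, {in `[0, 1], h =1 psi 0%N} & ip h h <= 1].
Proof.
move=> mu1; apply: (rkhs_mem_of_dominated HK) => l nl.
pose S n := \sum_(u <- l) \sum_(v <- l)
  u.1 * v.1 * series (fun k => mu k * psi k u.2 * psi k v.2) n.
have Slim : S @ \oo --> \sum_(u <- l) \sum_(v <- l) u.1 * v.1 * K u.2 v.2.
  apply: cvg_sum_seq => u ul; apply: cvg_sum_seq => v vl.
  apply: cvgM; first exact: cvg_cst.
  by apply: (mercer_sum Kmu); exact: (allP nl).
have SE n : S n = \sum_(0 <= k < n) mu k * (\sum_(u <- l) u.1 * psi k u.2) ^+ 2.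
  rewrite /S /series/=.
  under eq_bigr do (under eq_bigr do rewrite mulr_sumr; rewrite exchange_big/=).
  rewrite exchange_big/=; apply: eq_bigr => k _.
  rewrite expr2 mulr_suml mulr_sumr; apply: eq_bigr => u _.
  by rewrite !mulr_sumr; apply: eq_bigr => v _; ring.
apply: (cvg_ge_lim Slim).
exists 1%N => // -[//|n] _ /=; rewrite SE big_nat_recl// mu1 mul1r lerDl.
by apply: sumr_ge0 => k _; rewrite mulr_ge0 ?sqr_ge0 ?(mercer_ge0 Kmu).
Qed.

End mercer.

(** * Overlaps of random subsets *)

Section overlap.
Context (R : realType) (T : finType).
Implicit Types A S U : {set T}.

Lemma sum_subset_exp A (u : R) : \sum_(U : {set T} | U \subset A) u ^+ #|U| = (1 + u) ^+ #|A|.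
Proof.
rewrite exprDn (partition_big (fun U : {set T} => inord #|U| : 'I_#|A|.+1) xpredT)//=.
apply: eq_bigr => k _; rewrite expr1n mul1r.
rewrite (eq_bigl (fun U => U \in [set B : {set T} | B \subset A & #|B| == k]%SET)); last first.
  move=> U; rewrite inE; apply: andb_id2l => UA.
  by rewrite -val_eqE /= inordK// ltnS subset_leq_card.
rewrite (eq_bigr (fun=> u ^+ k)); last by move=> U; rewrite inE => /andP[_ /eqP->].
by rewrite sumr_const cards_draws.
Qed.

(** The probability that a uniform [s]-subset of a [p]-set contains [k] given
points is a product of [k] factors [(s - i) / (p - i)], each at most
[s / p]. *)
Lemma bin_sub_le p s k : (k <= s)%N -> (s <= p)%N ->
  ('C(p - k, s - k) * p ^ k <= s ^ k * 'C(p, s))%N.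
Proof.
move=> + sp; elim: k => [_|k IH ks]; first by rewrite !subn0 !expn0 muln1 mul1n.
have {}IH := IH (ltnW ks).
have pk : (0 < p - k)%N by rewrite subn_gt0 (leq_trans ks).
rewrite -(leq_pmul2l pk) mulnA !subnS mul_bin_diag prednK ?subn_gt0//.
have cross : ((s - k) * p <= s * (p - k))%N.
  by rewrite mulnBl mulnBr (mulnC s k) leq_sub2l// leq_mul2l sp orbT.
apply: (@leq_trans ((s - k) * p * (s ^ k * 'C(p, s)))%N).
  by have := leq_mul (leqnn ((s - k) * p)) IH; rewrite expnS; nia.
apply: (@leq_trans (s * (p - k) * (s ^ k * 'C(p, s)))%N); first by rewrite leq_mul2r cross orbT.
by rewrite expnS; lia.
Qed.

Lemma card_supersets_le U s : (#|U| <= s)%N ->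
  (#|[set A : {set T} | U \subset A & #|A| == s]%SET| <= 'C(#|T| - #|U|, s - #|U|))%N.
Proof.
move=> Us; set F := [set A | _]%SET.
have -> : (#|T| - #|U| = #|~: U|)%N by rewrite (cardsCs (~: U)) finset.setCK.
rewrite -cards_draws -(@card_in_imset _ _ (fun A : {set T} => A :\: U)).
  apply/subset_leq_card/fintype.subsetP => _ /imsetP[A + ->]; rewrite !inE => /andP[UA /eqP As].
  by rewrite finset.setDE finset.subsetIr -finset.setDE finset.cardsD (finset.setIidPr UA) As/=.
move=> A B; rewrite !inE => /andP[UA _] /andP[UB _] AB.
by rewrite -(finset.setID A U) -(finset.setID B U) (finset.setIidPr UA) (finset.setIidPr UB) AB.
Qed.

(** The moment generating function of a hypergeometric overlap is bounded by that
of the binomial one with the same mean: expanding [(1 + u) ^+ #|S :&: A|] over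
the subsets [U] of [S :&: A] and exchanging sums leaves the number of [A]
containing [U]. *)
Lemma sum_exp_overlap S (s : nat) (u : R) : (s <= #|T|)%N -> #|S| = s -> 0 <= u ->
  \sum_(A : {set T} | #|A| == s) (1 + u) ^+ #|S :&: A| <=
  'C(#|T|, s)%:R * (1 + u * (s%:R / #|T|%:R)) ^+ s.
Proof.
move=> sT Ss u0.
have [T0|T0] := posnP #|T|.
  move: sT; rewrite T0 leqn0 => /eqP s0; rewrite s0 bin0 expr0 mulr1.
  rewrite (big_pred1 finset.set0) => [|A]; last exact: cards_eq0.
  by rewrite finset.setI0 cards0.
under eq_bigr do rewrite -sum_subset_exp.
rewrite (exchange_big_dep (fun U => U \subset S))/=; last first.
  by move=> A U _; rewrite finset.subsetI => /andP[].
rewrite -Ss -sum_subset_exp mulr_sumr; apply: ler_sum => U US.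
rewrite (eq_bigl (fun A => A \in [set B : {set T} | U \subset B & #|B| == #|S|]%SET)); last first.
  by move=> A; rewrite !inE finset.subsetI US andbC.
rewrite sumr_const -[leLHS]mulr_natr [(u * _) ^+ _]exprMn [leRHS]mulrCA.
apply: ler_wpM2l; first exact: exprn_ge0.
have US' := subset_leq_card US.
rewrite exprMn exprVn mulrA ler_pdivlMr ?exprn_gt0 ?ltr0n// -!natrX -!natrM ler_nat [leqRHS]mulnC.
apply: leq_trans (bin_sub_le US' _); last by rewrite Ss.
by rewrite leq_mul2r card_supersets_le// orbT.
Qed.

Lemma card_size_sets (s : nat) : #|[pred S : {set T} | #|S| == s]| = 'C(#|T|, s).
Proof. by rewrite -card_draws -cardsE; apply: eq_card => S; rewrite !inE. Qed.

End overlap.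

(** Bernoulli's inequality for the exponent [t], with base [expR y]. *)
Lemma expR_mul_le (R : realType) (t y : R) : 0 <= t <= 1 ->
  expR (t * y) <= 1 + t * (expR y - 1).
Proof.
move=> t01; have := @convex_expR R (Itv01 (andP t01).1 (andP t01).2) y 0.
rewrite !convRE/= expR0 mulr0 addr0 mulr1 => H.
by rewrite (le_trans H)// /unstable.onem; lra.
Qed.

Lemma sum_exp_overlap_le (R : realType) (T : finType) (S : {set T}) (n s : nat)
    (kappa c eta : R) :
  (0 < s)%N -> (s <= #|T|)%N -> #|S| = s -> 0 < kappa ->
  kappa * n%:R <= ln (1 + #|T|%:R / s%:R ^+ 2) ->
  c ^+ 2 <= kappa -> c ^+ 2 <= kappa * ln (1 + 4 * eta ^+ 2) ->
  \sum_(A : {set T} | #|A| == s) expR (n%:R * c ^+ 2 * #|S :&: A|%:R) <=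
  'C(#|T|, s)%:R * (1 + 4 * eta ^+ 2).
Proof.
move=> s0 sT Ss k0 n_le c_le1 c_le2.
pose t := c ^+ 2 / kappa; set x := #|T|%:R / s%:R ^+ 2 in n_le.
have t0 : 0 <= t by rewrite divr_ge0 ?sqr_ge0 ?ltW.
have t1 : t <= 1 by rewrite ler_pdivrMr// mul1r.
have x0 : 0 <= x by rewrite divr_ge0.
pose u := expR (n%:R * c ^+ 2) - 1.
have u0 : 0 <= u by rewrite subr_ge0 -expR0 ler_expR mulr_ge0// sqr_ge0.
have u_le : u <= t * x.
  rewrite lerBlDl; apply: (@le_trans _ _ (expR (t * ln (1 + x)))).
    rewrite ler_expR; apply: le_trans (ler_wpM2l t0 n_le).
    by rewrite le_eqVlt; apply/orP; left; apply/eqP; rewrite /t; field; rewrite gt_eqF.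
  apply: le_trans (expR_mul_le _ _) _; first by rewrite t0.
  by rewrite lnK ?posrE ?ltr_pwDl// addrAC subrr add0r.
rewrite (eq_bigr (fun A => (1 + u) ^+ #|S :&: A|)); last first.
  by move=> A _; rewrite /u addrC subrK expRM_natr.
apply: le_trans (sum_exp_overlap sT Ss u0) _; apply: ler_wpM2l => //.
have Tgt0 : (0 < #|T|)%N by exact: leq_trans sT.
have p0 : (#|T|%:R : R) != 0 by rewrite pnatr_eq0 -lt0n.
have s0' : (s%:R : R) != 0 by rewrite pnatr_eq0 -lt0n.
apply: (@le_trans _ _ ((1 + t / s%:R) ^+ s)).
  apply: lerXn2r; [|by rewrite nnegrE addr_ge0// divr_ge0|].
    by rewrite nnegrE addr_ge0// mulr_ge0// divr_ge0.
  rewrite lerD2l; apply: le_trans (ler_wpM2r _ u_le) _; first by rewrite divr_ge0.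
  by rewrite [leLHS](_ : _ = t / s%:R)// /x; field; apply/andP.
apply: (@le_trans _ _ (expR (t / s%:R) ^+ s)).
  apply: lerXn2r; rewrite ?nnegrE ?expR_ge0 ?expR_ge1Dx//.
  by rewrite addr_ge0// divr_ge0.
rewrite -[leRHS]lnK; last by rewrite posrE ltr_pwDl// mulr_ge0// sqr_ge0.
rewrite -expRM_natr divfK// ler_expR.
by rewrite ler_pdivrMr// mulrC.
Qed.

(** * Integrals of product functions *)

Section integral_of_products.

Lemma integrable_patch d (T : measurableType d) (R : realType)
    (mu : {measure set T -> \bar R}) (D : set T) (f : T -> R) : measurable D ->
  mu.-integrable D (EFin \o f) <-> mu.-integrable setT (EFin \o (f \_ D)).
Proof.
move=> mD; rewrite (_ : EFin \o (f \_ D) = (EFin \o f) \_ D).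
  exact: integrable_mkcond.
by rewrite restrict_EFin.
Qed.

(** The Fubini statements below are for signed integrands, since the signals
change sign. *)
Lemma integrable_tensor d1 d2 (T1 : measurableType d1) (T2 : measurableType d2)
    (R : realType) (m1 : {sigma_finite_measure set T1 -> \bar R})
    (m2 : {sigma_finite_measure set T2 -> \bar R}) (f : T1 -> R) (g : T2 -> R) :
  m1.-integrable setT (EFin \o f) -> m2.-integrable setT (EFin \o g) ->
  (m1 \x m2)%E.-integrable setT (fun z => (f z.1 * g z.2)%:E).
Proof.
move=> if_ ig; have mf := measurable_int m1 if_; have mg := measurable_int m2 ig.
have mNf : measurable_fun setT (EFin \o (fun x => `|f x|)).
  by apply/measurable_EFinP; apply: measurableT_comp => //; exact/measurable_EFinP.
have mNg : measurable_fun setT (EFin \o (fun x => `|g x|)).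
  by apply/measurable_EFinP; apply: measurableT_comp => //; exact/measurable_EFinP.
have mfg : measurable_fun setT (EFin \o (fun z : T1 * T2 => f z.1 * g z.2)).
  apply/measurable_EFinP; apply: measurable_funM.
    by apply: measurableT_comp => //; exact/measurable_EFinP.
  by apply: measurableT_comp => //; exact/measurable_EFinP.
apply/integrable12ltyP => //=.
under eq_integral => x _.
  under eq_integral do rewrite normrM EFinM.
  rewrite ge0_integralZl//. over.
have /integrableP[_ Ng] := ig; have /integrableP[_ Nf] := if_.
rewrite -(fineK (x := (\int[m2]_y `|(EFin \o g) y|)%E)); last first.
  by rewrite ge0_fin_numE//; exact: integral_ge0.
rewrite ge0_integralZr//=.
- apply: lte_mul_pinfty; [exact: integral_ge0| |exact: ltry].
  by rewrite ge0_fin_numE//; exact: integral_ge0.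
- by rewrite lee_fin fine_ge0// integral_ge0.
Qed.

Lemma Rintegral_tensor d1 d2 (T1 : measurableType d1) (T2 : measurableType d2)
    (R : realType) (m1 : {sigma_finite_measure set T1 -> \bar R})
    (m2 : {sigma_finite_measure set T2 -> \bar R}) (f : T1 -> R) (g : T2 -> R) :
  m1.-integrable setT (EFin \o f) -> m2.-integrable setT (EFin \o g) ->
  (\int[(m1 \x m2)%E]_z (f z.1 * g z.2) = \int[m1]_x f x * \int[m2]_x g x)%R.
Proof.
move=> if_ ig; rewrite /Rintegral -integral12_prod_meas1; last exact: integrable_tensor.
rewrite -fineM; [|exact: integrable_fin_num..].
congr fine; rewrite /fubini_F/=.
under eq_integral => x _.
  under eq_integral do rewrite EFinM.
  rewrite integralZl//. over.
rewrite -(fineK (x := (\int[m2]_y (g y)%:E)%E)); last exact: integrable_fin_num.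
by rewrite integralZr// fineK//; exact: integrable_fin_num.
Qed.

Context (R : realType).
Notation leb := (@lebesgue_measure R).

(** The common source of all integrals on the cube and of the product structure
of Gaussian densities. *)
Lemma prod_integral (p : nat) (F : 'I_p -> R -> R) :
  (forall i, leb.-integrable setT (EFin \o F i)) ->
  (lebesgue_tuple R p).-integrable setT
    (fun x => (\prod_i F i (tnth x i))%:E) /\
  (\int[lebesgue_tuple R p]_x \prod_i F i (tnth x i) =
   \prod_i \int[leb]_x F i x)%R.
Proof.
elim: p F => [|p IH] F intF.
  under [X in integrable _ _ X]eq_fun do rewrite big_ord0.
  split.
    apply/integrableP; split; first exact: measurable_cst.
    by rewrite integral_cst//= diracT mule1 ltry.
  rewrite big_ord0 /Rintegral; under eq_integral do rewrite big_ord0.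
  by rewrite integral_cst//= mul1r indicT.
have [intF' IF'] := IH _ (fun i => intF (lift ord0 i)).
pose G (x : p.-tuple (measurableTypeR R)) := \prod_i F (lift ord0 i) (tnth x i).
have splitF z : \prod_i F i (tnth (tcons z) i) = F ord0 z.1 * G z.2.
  rewrite big_ord_recl; congr (_ * _); apply: eq_bigr => i _.
  by rewrite /tcons tnthS.
have int_tensor := integrable_tensor (intF ord0) intF'.
have mF : measurable_fun setT (EFin \o (fun x : p.+1.-tuple (measurableTypeR R) =>
    \prod_i F i (tnth x i))).
  apply/measurable_EFinP; apply: measurable_prod => i _.
  apply: (measurableT_comp (f := F i)); last exact: measurable_tnth.
  by apply/measurable_EFinP; exact: measurable_int (intF i).
have intT : ((leb \x lebesgue_tuple R p)%E).-integrable (tcons (n:=p) @^-1` setT)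
    ((fun x : p.+1.-tuple (measurableTypeR R) => (\prod_i F i (tnth x i))%:E) \o @tcons _ p).
  rewrite preimage_setT; apply: eq_integrable int_tensor => // z _ /=.
  by rewrite splitF.
split.
  exact: (integrable_pushforward (@measurable_tcons R p) mF intT).
rewrite big_ord_recl -IF' -Rintegral_tensor// /Rintegral.
congr fine; rewrite (integral_pushforward (@measurable_tcons R p) mF intT)//.
by rewrite preimage_setT; apply: eq_integral => z _ /=; rewrite splitF.
Qed.

Lemma measurable_rect (p : nat) (A : 'I_p -> set R) : (forall k, measurable (A k)) ->
  measurable [set x : p.-tuple (measurableTypeR R) | forall k, A k (tnth x k)].
Proof.
move=> mA; rewrite (_ : [set x | _] =
    \bigcap_(k in [set: 'I_p]) ((@tnth _ _ ^~ k) @^-1` A k)); last first.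
  by apply/seteqP; split=> x /= H => [k _|k]; exact: H.
apply: fin_bigcap_measurable => [|k _]; first exact: finite_finset.
by rewrite -[X in measurable X]setTI; apply: measurable_tnth => //; exact: mA.
Qed.

Lemma rect_integral (p : nat) (A : 'I_p -> set R) (F : 'I_p -> R -> R) :
  (forall k, measurable (A k)) ->
  (forall k, leb.-integrable (A k) (EFin \o F k)) ->
  let Q := [set x : p.-tuple (measurableTypeR R) | forall k, A k (tnth x k)] in
  (lebesgue_tuple R p).-integrable Q
    (EFin \o (fun x => \prod_k F k (tnth x k))) /\
  (\int[lebesgue_tuple R p]_(x in Q) \prod_k F k (tnth x k) =
   \prod_k \int[leb]_(x in A k) F k x)%R.
Proof.
move=> mA intF Q.
have int_patch k : leb.-integrable setT (EFin \o (F k \_ (A k))).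
  by apply: (integrable_patch _ _ _).1; [exact: mA|exact: intF].
have [iprod Eprod] := prod_integral int_patch.
have E : (fun x => \prod_k F k (tnth x k)) \_ Q =
    fun x : p.-tuple (measurableTypeR R) => \prod_k (F k \_ (A k)) (tnth x k).
  apply/funext => x; rewrite patchE; case: ifPn => [|/negP].
    rewrite inE /= => Ax; apply: eq_bigr => k _.
    by rewrite patchE ifT// inE.
  rewrite inE /= => /existsNP[k nAk]; symmetry.
  by rewrite (bigD1 k)//= patchE ifF ?mul0r//; apply/negP; rewrite inE.
split.
  apply: (integrable_patch _ _ _).2; first exact: measurable_rect.
  by rewrite E.
rewrite Rintegral_mkcond E Eprod; apply: eq_bigr => k _.
by rewrite [RHS]Rintegral_mkcond.
Qed.

End integral_of_products.

(** * Mixtures of product Gaussian densities *)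

Lemma Rintegral_lincomb d (T : measurableType d) (R : realType)
    (mu : {measure set T -> \bar R}) (D : set T) (mD : measurable D)
    (I : Type) (r : seq I) (P : pred I) (c : I -> R) (f : I -> T -> R) :
  (forall i, P i -> mu.-integrable D (EFin \o f i)) ->
  mu.-integrable D (EFin \o (fun x => \sum_(i <- r | P i) c i * f i x)) /\
  (\int[mu]_(x in D) \sum_(i <- r | P i) c i * f i x =
   \sum_(i <- r | P i) c i * \int[mu]_(x in D) f i x)%R.
Proof.
move=> intf; elim: r => [|i r [IHi IHe]].
  have E0 x : \sum_(i <- [::] | P i) c i * f i x = 0 by rewrite big_nil.
  split; first by apply: eq_integrable (integrable0 mu D) => // x _ /=; rewrite E0.
  rewrite big_nil; under eq_Rintegral do rewrite E0.
  by rewrite Rintegral_cst// mul0r.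
have [Pi|nPi] := boolP (P i); last first.
  have E x : \sum_(j <- i :: r | P j) c j * f j x = \sum_(j <- r | P j) c j * f j x.
    by rewrite big_cons (negbTE nPi).
  split; first by apply: eq_integrable IHi => // x _ /=; rewrite E.
  by rewrite big_cons (negbTE nPi) -IHe; apply: eq_Rintegral => x _; rewrite E.
have E x : \sum_(j <- i :: r | P j) c j * f j x =
    c i * f i x + \sum_(j <- r | P j) c j * f j x by rewrite big_cons Pi.
have ici : mu.-integrable D (EFin \o (fun x => c i * f i x)).
  by apply: eq_integrable (integrableZl mD (c i) (intf i Pi)) => // x _.
split.
  by apply: eq_integrable (integrableD mD ici IHi) => // x _ /=; rewrite E.
rewrite big_cons Pi -IHe -RintegralZl//; last exact: intf.
rewrite -RintegralD//; by apply: eq_Rintegral => x _; rewrite E.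
Qed.

Section gaussian.
Context (R : realType) (M : nat).
Notation vec := (M.-tuple (measurableTypeR R)).
Notation leb := (lebesgue_tuple R M).
Implicit Types (sigma tau : 'I_M -> R) (A : set vec).

Definition gauss_pdf sigma tau (x : vec) : R :=
  \prod_k normal_pdf (tau k) (sigma k) (tnth x k).

Lemma integrable_gauss_pdf sigma tau :
  leb.-integrable setT (EFin \o gauss_pdf sigma tau).
Proof.
have [H _] := @prod_integral R M (fun k => normal_pdf (tau k) (sigma k))
  (fun k => integrable_normal_pdf _ _).
exact: H.
Qed.

Lemma Rintegral_gauss_pdf sigma tau : (\int[leb]_x gauss_pdf sigma tau x = 1)%R.
Proof.
have [_ ->] := @prod_integral R M (fun k => normal_pdf (tau k) (sigma k))
  (fun k => integrable_normal_pdf _ _).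
by rewrite big1// => k _; rewrite /Rintegral integral_normal_pdf.
Qed.

Lemma gauss_pdf_ge0 sigma tau x : 0 <= gauss_pdf sigma tau x.
Proof. by apply: prodr_ge0 => k _; exact: normal_pdf_ge0. Qed.

Lemma normal_pdf_gt0 (m s x : R) : s != 0 -> 0 < normal_pdf m s x.
Proof. by move=> s0; rewrite normal_pdfE// mulr_gt0 ?expR_gt0// normal_peak_gt0. Qed.

(** Completing the square.  It turns the second moment of a likelihood ratio into
an exponential constant times a probability density. *)
Lemma normal_pdf_mul (a b s x : R) : s != 0 ->
  normal_pdf a s x * normal_pdf b s x =
  expR (a * b / s ^+ 2) * (normal_pdf 0 s x * normal_pdf (a + b) s x).
Proof.
move=> s0; rewrite !normal_pdfE// /normal_fun.
rewrite [LHS]mulrACA [X in _ = _ * X]mulrACA [RHS]mulrCA -!expRD; congr (_ * expR _).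
by field.
Qed.

Lemma gauss_pdf_mul sigma a b x : (forall k, sigma k != 0) ->
  gauss_pdf sigma a x * gauss_pdf sigma b x =
  expR (\sum_k a k * b k / sigma k ^+ 2) *
    (gauss_pdf sigma (fun=> 0) x * gauss_pdf sigma (a \+ b) x).
Proof.
move=> s0; rewrite /gauss_pdf expR_sum -!big_split/=.
by apply: eq_bigr => k _; exact: normal_pdf_mul.
Qed.

(** The quadratic [G] below dominates [p0 - pbar] and is nonnegative, so that its
integral over [A] is at most its full integral; the latter is
[chi^2 / (8 eta) + eta / 2], where [chi^2] is the chi-square divergence of the
mixture, at most [4 eta ^+ 2].  This replaces the Cauchy-Schwarz inequality, the weight
[2 eta] of the arithmetic-geometric mean inequality being the optimal one when
[chi^2 = 4 eta ^+ 2]. *)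
Lemma gauss_mixture_le sigma (I : finType) (D : {pred I}) (tau : I -> 'I_M -> R)
    (eta : R) A :
  (forall k, sigma k != 0) -> (0 < #|D|)%N -> 0 < eta ->
  \sum_(i in D) \sum_(j in D) expR (\sum_k tau i k * tau j k / sigma k ^+ 2) <=
    #|D|%:R ^+ 2 * (1 + 4 * eta ^+ 2) ->
  measurable A ->
  (\int[leb]_(x in A) gauss_pdf sigma (fun=> 0) x <=
   #|D|%:R^-1 * \sum_(i in D) \int[leb]_(x in A) gauss_pdf sigma (tau i) x + eta)%R.
Proof.
move=> s0 D0 eta0 chi mA.
pose N : R := #|D|%:R; have N0 : 0 < N by rewrite ltr0n.
pose p0 := gauss_pdf sigma (fun=> 0).
pose pbar x := \sum_(i in D) N^-1 * gauss_pdf sigma (tau i) x.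
pose e i j := expR (\sum_k tau i k * tau j k / sigma k ^+ 2).
pose qi i x := \sum_(j in D) e i j * gauss_pdf sigma (tau i \+ tau j) x.
pose q x := \sum_(i in D) N ^- 2 * qi i x.
have intp t : leb.-integrable setT (EFin \o gauss_pdf sigma t).
  exact: integrable_gauss_pdf.
have [ipbar Epbar] := Rintegral_lincomb measurableT (index_enum I)
  (fun=> N^-1) (fun i (_ : i \in D) => intp (tau i)).
have iqi i := Rintegral_lincomb measurableT (index_enum I)
  (e i) (fun j (_ : j \in D) => intp (tau i \+ tau j)).
have [iq Eq] := Rintegral_lincomb measurableT (index_enum I)
  (fun=> N ^- 2) (fun i (_ : i \in D) => (iqi i).1).
have pbar1 : (\int[leb]_x pbar x = 1)%R.
  rewrite Epbar; under eq_bigr do rewrite Rintegral_gauss_pdf mulr1.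
  by rewrite sumr_const -mulr_natl divff// gt_eqF.
have q1 : (\int[leb]_x q x <= 1 + 4 * eta ^+ 2)%R.
  rewrite Eq -mulr_sumr mulrC ler_pdivrMr ?exprn_gt0// mulrC.
  apply: le_trans chi; rewrite le_eqVlt; apply/orP; left; apply/eqP.
  apply: eq_bigr => i _; rewrite (iqi i).2; apply: eq_bigr => j _.
  by rewrite Rintegral_gauss_pdf mulr1.
have p0_gt0 x : 0 < p0 x by apply: prodr_gt0 => k _; exact: normal_pdf_gt0.
have sqr_pbar x : pbar x ^+ 2 = q x * p0 x.
  rewrite /pbar -mulr_sumr exprMn exprVn /q -mulr_sumr -mulrA; congr (_ * _).
  rewrite expr2 mulr_suml mulr_suml; apply: eq_bigr => i _.
  rewrite mulr_sumr mulr_suml; apply: eq_bigr => j _.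
  by rewrite gauss_pdf_mul// -/p0 -/(e i j); ring.
(* [G] is [(p0 - pbar) / 2 + (p0 - pbar)^2 / (8 eta p0) + eta p0 / 2], written
   through [q = pbar^2 / p0] as a combination of integrable functions. *)
pose w := fun k : 'I_3 => [tuple 2^-1 + (8 * eta)^-1 + eta / 2;
  - 2^-1 - (4 * eta)^-1; (8 * eta)^-1]`_k.
pose g := fun k : 'I_3 => nth p0 [:: p0; pbar; q] k.
pose G x := \sum_k w k * g k x.
have intg k : true -> leb.-integrable setT (EFin \o g k).
  by case: k => -[|[|[|k]]] k3 _; [exact: intp|exact: ipbar|exact: iq|by []].
have [iG EG] := Rintegral_lincomb measurableT (index_enum 'I_3) (w) intg.
have GE x : G x = (p0 x - pbar x) / 2 + (q x - 2 * pbar x + p0 x) / (8 * eta)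
    + eta / 2 * p0 x.
  by rewrite /G !big_ord_recl big_ord0 /w /g/=; field; rewrite gt_eqF.
have dev x : p0 x * G x = p0 x * (p0 x - pbar x) / 2 +
    ((p0 x - pbar x) ^+ 2 + (2 * eta * p0 x) ^+ 2) / (8 * eta).
  rewrite GE (_ : (p0 x - pbar x) ^+ 2 = q x * p0 x - 2 * p0 x * pbar x + p0 x ^+ 2).
    by field; rewrite gt_eqF.
  by rewrite -sqr_pbar; ring.
have amgm x : `|p0 x - pbar x| * p0 x / 2 <=
    ((p0 x - pbar x) ^+ 2 + (2 * eta * p0 x) ^+ 2) / (8 * eta).
  rewrite ler_pdivlMr ?mulr_gt0// -[(p0 x - pbar x) ^+ 2]real_normK ?num_real//.
  by have := sqr_ge0 (`|p0 x - pbar x| - 2 * eta * p0 x); nra.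
have G_ge x : p0 x - pbar x <= G x.
  rewrite -(ler_pM2l (p0_gt0 x)) dev; apply: le_trans (lerD (lexx _) (amgm x)).
  by have := ler_norm (p0 x - pbar x); have := p0_gt0 x; nra.
have G_ge0 x : 0 <= G x.
  rewrite -(pmulr_rge0 _ (p0_gt0 x)) dev; apply: le_trans (lerD (lexx _) (amgm x)).
  by have := ler_norm (- (p0 x - pbar x)); rewrite normrN; have := p0_gt0 x; nra.
have intG : (\int[leb]_x G x <= eta)%R.
  rewrite EG !big_ord_recl big_ord0 /w /g/= Rintegral_gauss_pdf pbar1 addr0.
  apply: (@le_trans _ _ (2^-1 + (8 * eta)^-1 + eta / 2 + (- 2^-1 - (4 * eta)^-1) +
    (8 * eta)^-1 * (1 + 4 * eta ^+ 2))); last first.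
    by rewrite le_eqVlt; apply/orP; left; apply/eqP; field; rewrite gt_eqF.
  rewrite !mulr1 addrA lerD2l; apply: ler_wpM2l => //.
  by rewrite invr_ge0 mulr_ge0// ltW.
have toA f : leb.-integrable setT (EFin \o f) -> leb.-integrable A (EFin \o f).
  by apply: integrableS.
rewrite -lerBlDl mulr_sumr.
have [_ <-] := Rintegral_lincomb mA (index_enum I) (fun=> N^-1)
  (fun i (_ : i \in D) => toA _ (intp (tau i))).
rewrite -RintegralB//; [|exact: toA..].
apply: le_trans (intG); apply: (@le_trans _ _ (\int[leb]_(x in A) G x)%R).
  apply: le_Rintegral; [exact: mA| |exact: toA|by move=> x _; exact: G_ge].
  apply: eq_integrable (integrableB mA (toA _ (intp (fun=> 0))) (toA _ ipbar)) => //.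
rewrite Rintegral_mkcond; apply: le_Rintegral => //.
  by apply/(integrable_patch _ _ mA); exact: toA.
by move=> x _; rewrite patchE; case: ifP.
Qed.

End gaussian.

(** * Laws of independent Gaussian variables *)

Lemma normal_prob_shift (R : realType) (m s t : R) (A : set R) :
  s != 0 -> measurable A ->
  normal_prob m s [set x | A (x + t)] = normal_prob (m + t) s A.
Proof.
move=> s0 mA; pose shift (x : measurableTypeR R) : measurableTypeR R := x + t.
have mshift : measurable_fun setT shift by exact: measurable_funD.
have shift_leb B : measurable B -> lebesgue_measure B = pushforward lebesgue_measure shift B.
  apply: (lebesgue_measure_unique (mu := pushforward lebesgue_measure shift)) => _ [[a b] _ <-].
  rewrite /= /pushforward.
  rewrite (_ : shift @^-1` _ = `]a - t, b - t]%classic); last first.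
    by apply/seteqP; split=> x; rewrite /= !in_itv/= ltrBlDr lerBrDr.
  rewrite !lebesgue_measure_itv/= !lte_fin ltrD2r; case: ifP => // _.
  by rewrite -!EFinB; congr EFin; lra.
have mf : measurable_fun setT (EFin \o normal_pdf (m + t) s).
  by apply/measurable_EFinP; exact: measurable_normal_pdf.
rewrite /normal_prob [RHS](eq_measure_integral (pushforward lebesgue_measure shift)); last first.
  by move=> B mB _; exact: shift_leb.
rewrite ge0_integral_pushforward//; last 2 first.
- exact: measurable_funS mf.
- by move=> x _; rewrite lee_fin normal_pdf_ge0.
apply: eq_integral => x _ /=; congr EFin.
by rewrite !normal_pdfE// /normal_fun /shift opprD addrACA subrr addr0.
Qed.

(** Rectangles are stable under intersection, so that a law on tuples is
determined by its values on them. *)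
Lemma measurable_tuple_rect (R : realType) (M : nat) :
  @measurable _ (M.-tuple (measurableTypeR R)) =
  <<s [set B | exists2 A : 'I_M -> set R, (forall k, measurable (A k)) &
        B = [set x | forall k, A k (tnth x k)]] >>.
Proof.
apply/seteqP; split.
  apply: smallest_sub; first exact: smallest_sigma_algebra.
  move=> B; rewrite -bigcup_seq => -[k _ [C mC <-]]; apply: sub_sigma_algebra.
  exists (fun l => if l == k then C else setT); first by move=> l; case: eqP.
  rewrite setTI; apply/seteqP; split=> x /=.
    by move=> Cx l; case: eqP => // ->.
  by move=> /(_ k); rewrite eqxx.
apply: smallest_sub; first exact: sigma_algebra_measurable.
move=> _ [A mA ->].
exact: measurable_rect.
Qed.

Section gauss_law.
Context (R : realType) (M : nat).
Notation vec := (M.-tuple (measurableTypeR R)).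
Notation leb := (lebesgue_tuple R M).
Context (sigma tau : 'I_M -> R).

Definition gauss_prob (A : set vec) : \bar R :=
  (\int[leb]_(x in A) (gauss_pdf sigma tau x)%:E)%E.

Let gauss_prob0 : gauss_prob set0 = 0%E.
Proof. exact: integral_set0. Qed.

Let gauss_prob_ge0 A : (0 <= gauss_prob A)%E.
Proof. by apply: integral_ge0 => x _; rewrite lee_fin gauss_pdf_ge0. Qed.

Let gauss_prob_sigma_additive : semi_sigma_additive gauss_prob.
Proof.
move=> F mF tF mUF; rewrite /gauss_prob integral_bigcup//; last first.
  by apply: integrableS (integrable_gauss_pdf sigma tau).
apply: is_cvg_ereal_nneg_natsum_cond => n _ _; exact: gauss_prob_ge0.
Qed.

HB.instance Definition _ := isMeasure.Build _ _ _ gauss_prob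
  gauss_prob0 gauss_prob_ge0 gauss_prob_sigma_additive.

Lemma gauss_prob_rect (A : 'I_M -> set R) : (forall k, measurable (A k)) ->
  gauss_prob [set x | forall k, A k (tnth x k)] =
  (\prod_k normal_prob (tau k) (sigma k) (A k))%E.
Proof.
move=> mA; have int_pdf k : lebesgue_measure.-integrable (A k)
    (EFin \o normal_pdf (tau k) (sigma k)).
  by apply: (integrableS _ _ _ (integrable_normal_pdf _ _)) => //; exact: mA.
have [irect Erect] := rect_integral mA int_pdf.
rewrite -[LHS]fineK; last exact: (integrable_fin_num (measurable_rect mA) irect).
rewrite [X in X%:E]Erect -prodEFin; apply: eq_bigr => k _.
by rewrite fineK//; apply: integrable_fin_num; [exact: mA|exact: int_pdf].
Qed.

Lemma law_gauss d (Omega : measurableType d) (P : probability Omega R)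
    (X : 'I_M -> Omega -> R) :
  (forall k, measurable_fun setT (X k)) ->
  (forall A : 'I_M -> set R, (forall k, measurable (A k)) ->
     P [set w | forall k, A k (X k w)] =
     (\prod_k normal_prob (tau k) (sigma k) (A k))%E) ->
  forall A : set vec, measurable A ->
    P [set w | A [tuple X k w | k < M]] = gauss_prob A.
Proof.
move=> mX rect A mA; pose f w : vec := [tuple X k w | k < M].
have mf : measurable_fun setT f.
  apply/measurable_fun_tnthP => k; apply: eq_measurable_fun (mX k) => w _.
  by rewrite /= tnth_mktuple.
apply: (@measure_unique _ R _ _ (fun=> setT) (measurable_tuple_rect R M) _ _ _
  (pushforward P f) gauss_prob) => //.
- move=> _ _ [B1 mB1 ->] [B2 mB2 ->]; exists (fun k => B1 k `&` B2 k).
    by move=> k; exact: measurableI.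
  apply/seteqP; split=> x /=; first by move=> [H1 H2] k.
  by move=> H; split=> k; have [] := H k.
- by move=> _; exists (fun=> setT) => //; apply/seteqP.
- exact: bigcup_const.
- move=> _ [B mB ->]; rewrite [RHS](gauss_prob_rect mB) -rect// /pushforward.
  congr (P _); apply/seteqP; split=> w /= H k; have := H k;
    by rewrite tnth_mktuple.
- by move=> _; rewrite [X in (X < _)%E](_ : _ = P setT)// probability_setT ltry.
Qed.

End gauss_law.

(** * Box increments on a grid *)

Section box_increment.
Context (R : realType) (p : nat).
Notation vec := (p.-tuple (measurableTypeR R)).
Implicit Types (F : vec -> R) (a b x : vec).

(** Inclusion-exclusion over the vertices of a box is the expansion of a
product. *)
Lemma signed_sum_prod (T : finType) (u v : T -> R) :
  \sum_(S : {set T}) (-1) ^+ #|~: S| * \prod_l (if l \in S then u l else v l) =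
  \prod_l (u l - v l).
Proof.
rewrite bigA_distr; apply: eq_bigr => S _.
rewrite (bigID (mem S))/= [RHS](bigID (mem S))/= mulrCA; congr (_ * _).
  by apply: eq_bigr => l ->.
rewrite -prodr_const (eq_bigl (fun l => l \notin S)); last by move=> l; rewrite inE.
rewrite -big_split/=; apply: eq_bigr => l /negbTE ->.
by rewrite mulN1r.
Qed.

Lemma box_increment_prod (h : 'I_p -> R -> R) a b :
  box_increment (fun x => \prod_l h l (tnth x l)) a b =
  \prod_l (h l (tnth b l) - h l (tnth a l)).
Proof.
rewrite -signed_sum_prod; apply: eq_bigr => S _; congr (_ * _).
by apply: eq_bigr => l _; rewrite tnth_mktuple; case: ifP.
Qed.

Lemma box_incrementD F1 F2 k a b :
  box_increment (fun x => F1 x + k * F2 x) a b =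
  box_increment F1 a b + k * box_increment F2 a b.
Proof.
rewrite /box_increment mulr_sumr -big_split/=; apply: eq_bigr => S _.
by rewrite mulrDr mulrCA.
Qed.

Lemma box_increment_sum (I : Type) (r : seq I) (P : pred I) (c : I -> R)
    (F : I -> vec -> R) a b :
  box_increment (fun x => \sum_(i <- r | P i) c i * F i x) a b =
  \sum_(i <- r | P i) c i * box_increment (F i) a b.
Proof.
rewrite /box_increment.
under eq_bigr do rewrite mulr_sumr.
rewrite exchange_big/=; apply: eq_bigr => i _.
by rewrite mulr_sumr; apply: eq_bigr => S _; rewrite mulrCA.
Qed.

Context (N : nat) (G : nat -> R).
Implicit Types v : {ffun 'I_p -> 'I_N.+1}.

(** The points of the grid with nodes [G 0 < ... < G N] on every axis, indexed by
integers so that identities on the grid do not involve the values of [G]. *)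
Definition grid_point (k : 'I_p -> nat) : vec := [tuple G (k l) | l < p].

(** On the grid, [F] is a combination of products of Kronecker deltas, and box
increments are linear; this brings every identity between increments on the
grid down to one-dimensional ones. *)
Lemma grid_increment F (k m : 'I_p -> nat) :
  (forall l, (k l <= N)%N) -> (forall l, (m l <= N)%N) ->
  box_increment F (grid_point k) (grid_point m) =
  \sum_(v : {ffun 'I_p -> 'I_N.+1}) F (grid_point (fun l => v l)) *
    \prod_l ((m l == v l)%:R - (k l == v l)%:R).
Proof.
move=> kN mN.
under [RHS]eq_bigr do rewrite -signed_sum_prod mulr_sumr.
rewrite exchange_big/=; apply: eq_bigr => S _.
pose x l := if l \in S then m l else k l.
have xN l : (x l < N.+1)%N by rewrite ltnS /x; case: ifP.
rewrite (bigD1 [ffun l => Ordinal (xN l)])//= [X in _ = _ + X]big1 ?addr0 => [|v vx].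
  rewrite mulrCA [X in _ * (_ * X)]big1 ?mulr1 => [|l _]; last first.
    by rewrite !ffunE/= /x; case: (l \in S); rewrite eqxx.
  congr (_ * F _); apply: eq_mktuple => l.
  by rewrite !ffunE !tnth_mktuple /= /x; case: ifP.
have [l vl] : exists l, v l != x l :> nat.
  apply/existsP; apply: contra_neqT vx => /existsPn vx; apply/ffunP => l.
  by apply/val_inj; rewrite ffunE /=; apply/eqP; have := vx l; rewrite negbK.
rewrite [\prod_l _](bigD1 l)//= (_ : (if _ then _ else _) = 0) ?mul0r ?mulr0//.
by move: vl; rewrite /x eq_sym; case: ifP => _ /negbTE->.
Qed.

Definition succ_cell (i : {ffun 'I_p -> 'I_N}) (l : 'I_p) : nat := (i l).+1.

Lemma grid_telescope F (m : 'I_p -> nat) : (forall l, (m l <= N)%N) ->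
  \sum_(i : {ffun 'I_p -> 'I_N} | [forall l, (i l < m l)%N])
    box_increment F (grid_point (fun l => i l)) (grid_point (succ_cell i)) =
  box_increment F (grid_point (fun=> 0%N)) (grid_point m).
Proof.
move=> mN; rewrite grid_increment//.
under eq_bigr => i _.
  rewrite grid_increment; [|by move=> l; exact: ltnW|by move=> l; exact: ltn_ord].
  over.
rewrite exchange_big/=; apply: eq_bigr => v _; rewrite -mulr_sumr; congr (_ * _).
rewrite (eq_bigl (fun i : {ffun 'I_p -> 'I_N} =>
    i \in family (fun l => [pred k : 'I_N | (k < m l)%N]))); last first.
  by move=> i; apply/forallP/familyP => H l; have := H l; rewrite inE.
rewrite -(bigA_distr_big_dep
  (fun l (k : 'I_N) => (k < m l)%N)
  (fun l (k : 'I_N) => (k.+1 == v l)%:R - (k == v l :> nat)%:R))/=.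
apply: eq_bigr => l _.
rewrite -(big_ord_widen N (fun k => (k.+1 == v l)%:R - (k == v l)%:R : R) (mN l)).
rewrite -(big_mkord xpredT (fun k => (k.+1 == v l)%:R - (k == v l)%:R : R)).
by rewrite telescope_sumr.
Qed.

(** Telescoping in all directions leaves the increment over [[0, m]], in which
only the vertex [m] lies off the coordinate hyperplanes. *)
Lemma grid_reconstruct F (m : 'I_p -> nat) : (forall l, (m l <= N)%N) ->
  (forall k : 'I_p -> nat, (forall l, (k l <= N)%N) ->
     (exists l, k l = 0%N) -> F (grid_point k) = 0) ->
  F (grid_point m) =
  \sum_(i : {ffun 'I_p -> 'I_N} | [forall l, (i l < m l)%N])
    box_increment F (grid_point (fun l => i l)) (grid_point (succ_cell i)).
Proof.
move=> mN F0; rewrite grid_telescope// /box_increment.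
rewrite (bigD1 finset.setT)//= big1 ?addr0 => [|S /eqP ST].
  rewrite finset.setCT cards0 expr0 mul1r; congr F; apply: eq_mktuple => l.
  by rewrite inE tnth_mktuple.
have [l lS] : exists l, l \notin S.
  apply/existsP; rewrite -negb_forall; apply/negP => /forallP SS.
  by apply: ST; apply/setP => l; rewrite SS inE.
rewrite (_ : [tuple _ | _ < p] = grid_point (fun l => if l \in S then m l else 0%N)).
  by rewrite F0 ?mulr0// => [k|]; [case: ifP|exists l; rewrite (negbTE lS)].
by apply: eq_mktuple => k; rewrite !tnth_mktuple; case: ifP.
Qed.

End box_increment.

(** * Primitives of square integrable functions *)

Section primitive.
Context (R : realType).
Notation leb := (@lebesgue_measure R).
Notation I01 := (`[0, 1]%classic : set R).

Definition primitive (f : R -> R) (u : R) : R := (\int[leb]_(x in `[0, u]) f x)%R.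

Lemma primitive0 f : primitive f 0 = 0.
Proof. by rewrite /primitive set_itv1 Rintegral_set1. Qed.

Lemma integrable_sub01 f (a b : itv_bound R) :
  leb.-integrable I01 (EFin \o f) -> [set` Interval a b] `<=` I01 ->
  leb.-integrable [set` Interval a b] (EFin \o f).
Proof. by move=> intf ab; apply: integrableS intf. Qed.

Lemma primitiveB f (a b : R) : leb.-integrable I01 (EFin \o f) ->
  0 <= a -> a <= b -> b <= 1 ->
  primitive f b - primitive f a = (\int[leb]_(x in `]a, b]) f x)%R.
Proof.
move=> intf a0 ab b1; rewrite /primitive; apply: Rintegral_itvB; rewrite ?bnd_simp//.
by apply: integrable_sub01 => // x; rewrite /= !in_itv/= => /andP[-> /le_trans->].
Qed.

Lemma integrable_cst_itv (k : R) (a b : R) (l r : bool) :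
  leb.-integrable [set` Interval (BSide l a) (BSide r b)] (EFin \o cst k).
Proof.
apply: measurable_bounded_integrable => //; last exact: bounded_cst.
by rewrite /= lebesgue_measure_itv; case: ifP => _; rewrite ?ltry//= -EFinB ltry.
Qed.

Lemma L2unit_integrable (f : R -> R) : L2unit f -> leb.-integrable I01 (EFin \o f).
Proof.
move=> [mf intf2].
have int1 : leb.-integrable I01 (EFin \o cst (1 : R)).
  exact: integrable_cst_itv.
apply: (le_integrable _ _ _ (integrableD _ int1 intf2)) => //.
  exact/measurable_EFinP.
move=> x _ /=; rewrite lee_fin [leRHS]ger0_norm ?addr_ge0 ?sqr_ge0//.
by rewrite -[f x ^+ 2]real_normK ?num_real//; have := sqr_ge0 (`|f x| - 1); nra.
Qed.

(** Jensen's inequality on one interval, obtained by integrating the square of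
[f] minus its mean. *)
Lemma primitive_sqr_le (f : R -> R) (a b : R) : L2unit f ->
  0 <= a -> a < b -> b <= 1 ->
  (primitive f b - primitive f a) ^+ 2 / (b - a) <=
  primitive (fun x => f x ^+ 2) b - primitive (fun x => f x ^+ 2) a.
Proof.
move=> L2f a0 ab b1; have w0 : 0 < b - a by rewrite subr_gt0.
have sub : [set` `]a, b] ] `<=` I01.
  move=> x; rewrite /= !in_itv/= => /andP[/ltW ax xb].
  by rewrite (le_trans a0 ax) (le_trans xb b1).
have intf := integrable_sub01 (L2unit_integrable L2f) sub.
have intf2 := integrable_sub01 L2f.2 sub.
have int1 : leb.-integrable `]a, b] (EFin \o cst (1 : R)).
  exact: integrable_cst_itv.
rewrite !primitiveB ?(ltW ab)//; [|exact: L2f.2|exact: L2unit_integrable].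
set m := (\int[leb]_(x in _) f x)%R; set q := (\int[leb]_(x in _) (f x ^+ 2))%R.
have width : (\int[leb]_(x in `]a, b]) (1 : R) = b - a)%R.
  rewrite Rintegral_cst//= mul1r lebesgue_measure_itv/= lte_fin ab.
  by rewrite -EFinB.
pose w := fun k : 'I_3 => [tuple 1; - (2 * (m / (b - a))); (m / (b - a)) ^+ 2]`_k.
pose g := fun k : 'I_3 => nth f [:: fun x => f x ^+ 2; f; cst 1] k.
have intg k : true -> leb.-integrable `]a, b] (EFin \o g k).
  by case: k => -[|[|[|k]]] k3 _; [exact: intf2|exact: intf|exact: int1|].
have [|_ EG] := (fun mD => @Rintegral_lincomb _ _ _ leb `]a, b]%classic mD _
  (index_enum 'I_3) xpredT w g intg); first exact: measurable_itv.
have : 0 <= (\int[leb]_(x in `]a, b]) \sum_k w k * g k x)%R.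
  apply: Rintegral_ge0 => x _; rewrite !big_ord_recl big_ord0 /w /g/=.
  rewrite (_ : _ + _ = (f x - m / (b - a)) ^+ 2) ?sqr_ge0//; ring.
rewrite EG !big_ord_recl big_ord0 /w /g/= width -/m -/q.
rewrite (_ : _ + _ = q - m ^+ 2 / (b - a)) ?subr_ge0//.
by field; rewrite gt_eqF.
Qed.

End primitive.

(** * Sparse additive signals *)

Section signal.
Context (R : realType) (h : R -> R) (p : nat) (c : R).
Context (h_L2 : L2unit h) (h_mean : L2unit_ip h (fun=> 1) = 0)
  (h_norm : L2unit_ip h h = 1).
Notation leb := (@lebesgue_measure R).
Notation vec := (p.-tuple (measurableTypeR R)).
Implicit Types (S T : {set 'I_p}) (x t : vec).

(** For [S] empty this is the null signal, so that the null hypothesis needs no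
separate treatment. *)
Definition signal S x : R := \sum_(j in S) c * h (tnth x j).

(** Functions of a single coordinate are products over all coordinates with
trivial factors, which makes the integrals of products available. *)
Let factor (j l : 'I_p) : R -> R := if l == j then h else cst 1.

Let factorE j x : h (tnth x j) = \prod_l factor j l (tnth x l).
Proof.
rewrite (bigD1 j)//= /factor eqxx big1 ?mulr1// => l lj.
by rewrite (negbTE lj).
Qed.

Let integrable_factor j l : leb.-integrable `[0, 1] (EFin \o factor j l).
Proof.
rewrite /factor; case: ifP => _; first exact: L2unit_integrable.
exact: integrable_cst_itv.
Qed.

(** The integral of [signal S] over the box [[0, t]], that is, the mean of the
observed process at [t]. *)
Definition drift S t : R :=
  \sum_(j in S) c * \prod_l (if l == j then primitive h (tnth t l) else tnth t l).

Lemma Rintegral_signal S t : cube t ->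
  (\int[lebesgue_tuple R p]_(x in [set x | forall i, (0 <= (tnth x i : R) <= tnth t i)%R])
     signal S x = drift S t)%R.
Proof.
move=> t01; pose A l := `[0, (tnth t l : R)]%classic : set R.
have mA l : measurable (A l) by exact: measurable_itv.
have intF j l : leb.-integrable (A l) (EFin \o factor j l).
  apply: integrable_sub01 => // y; rewrite /= !in_itv/= => /andP[-> yt].
  by have /andP[_] := t01 l; exact: le_trans.
rewrite (_ : [set x | _] = [set x : vec | forall l, A l (tnth x l)]); last first.
  by apply/seteqP; split=> x /= H l; have := H l; rewrite /A /= in_itv.
have [_ E] := Rintegral_lincomb (measurable_rect mA) (index_enum 'I_p) (fun=> c)
  (fun j (_ : j \in S) => (rect_integral mA (intF j)).1).
transitivity (\int[lebesgue_tuple R p]_(x in [set x : vec | forall l, A l (tnth x l)])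
    \sum_(j in S) c * \prod_l factor j l (tnth x l))%R.
  by apply: eq_Rintegral => x _; apply: eq_bigr => j _; rewrite factorE.
rewrite E; apply: eq_bigr => j _; congr (_ * _).
have [_ ->] := rect_integral mA (intF j); apply: eq_bigr => l _.
rewrite /A /factor; case: ifP => // _.
rewrite Rintegral_cst//= mul1r lebesgue_measure_itv/= lte_fin.
have /andP[] := t01 l; rewrite le_eqVlt => /predU1P[<- _|-> _]; first by rewrite ltxx.
by rewrite oppr0 addr0.
Qed.

Let A (l : 'I_p) : set R := `[0, 1]%classic.

Let mA l : measurable (A l). Proof. exact: measurable_itv. Qed.

Let cubeE : @cube R p = [set x : vec | forall l, A l (tnth x l)].
Proof. by apply/seteqP; split=> x /= H l; have := H l; rewrite /A /= in_itv. Qed.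

Lemma signal_sqr_integral S :
  (lebesgue_tuple R p).-integrable (@cube R p) (EFin \o (fun x => signal S x ^+ 2)) /\
  (\int[lebesgue_tuple R p]_(x in @cube R p) (signal S x ^+ 2) = c ^+ 2 * #|S|%:R)%R.
Proof.
pose F j m l (y : R) := factor j l y * factor m l y.
have intF j m l : leb.-integrable (A l) (EFin \o F j m l).
  rewrite /F /factor; case: ifP => _; case: ifP => _.
  - by apply: eq_integrable h_L2.2 => // x _ /=; rewrite expr2.
  - by apply: eq_integrable (L2unit_integrable h_L2) => // x _ /=; rewrite mulr1.
  - by apply: eq_integrable (L2unit_integrable h_L2) => // x _ /=; rewrite mul1r.
  - by apply: eq_integrable (integrable_cst_itv 1 0 1 true false) => // x _ /=; rewrite mul1r.
have Fprod j m : (\prod_l \int[leb]_(y in A l) F j m l y = (j == m)%:R)%R.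
  have [<-|jm] := eqVneq j m.
    rewrite big1// => l _; rewrite /F /factor; case: ifP => _; first exact: h_norm.
    rewrite (_ : (fun y => _) = fun=> 1); last by apply/funext => y; rewrite /= mulr1.
    rewrite Rintegral_cst; last exact: mA.
    rewrite mul1r /= lebesgue_measure_itv/= lte_fin ltr01.
    by rewrite oppr0 addr0.
  rewrite (bigD1 j)//= (_ : Rintegral _ _ _ = 0) ?mul0r//.
  by rewrite -[RHS]h_mean /F /factor eqxx (negbTE jm).
have inner j := Rintegral_lincomb (measurable_rect mA) (index_enum 'I_p) (fun=> c)
  (fun m (_ : m \in S) => (rect_integral mA (intF j m)).1).
have [intE E] := Rintegral_lincomb (measurable_rect mA) (index_enum 'I_p) (fun=> c)
  (fun j (_ : j \in S) => (inner j).1).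
have sqrE x : signal S x ^+ 2 =
    \sum_(j in S) c * \sum_(m in S) c * \prod_l F j m l (tnth x l).
  rewrite expr2 /signal mulr_suml; apply: eq_bigr => j _.
  rewrite -mulrA; congr (_ * _); rewrite mulr_sumr; apply: eq_bigr => m _.
  by rewrite !factorE mulrCA -big_split.
rewrite cubeE; split.
  apply: eq_integrable intE; first exact: measurable_rect.
  by move=> x _ /=; rewrite sqrE.
transitivity (\sum_(j in S) c * (\sum_(m in S) c * (j == m)%:R)); last first.
  rewrite (eq_bigr (fun=> c ^+ 2)); first by rewrite sumr_const mulr_natr.
  move=> j jS; rewrite (bigD1 j)//= eqxx big1 ?addr0 ?mulr1 ?expr2// => m /andP[_ mj].
  by rewrite eq_sym (negbTE mj) mulr0.
rewrite (eq_bigr _ (fun j _ => congr1 (fun z => c * z) (eq_bigr _ (fun m _ =>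
  congr1 (fun z => c * z) (esym (etrans (rect_integral mA (intF j m)).2 (Fprod j m))))))).
rewrite (eq_bigr _ (fun j _ => congr1 (fun z => c * z) (esym (inner j).2))) -E.
by apply: eq_Rintegral => x _; rewrite sqrE.
Qed.

Lemma cube_L2norm_signal S : 0 <= c ->
  cube_L2norm (signal S) = (c * Num.sqrt #|S|%:R)%:E.
Proof.
move=> c0; have [intS ES] := signal_sqr_integral S.
have mcube : measurable (@cube R p) by rewrite cubeE; exact: measurable_rect.
rewrite /cube_L2norm unlock.
rewrite (eq_integral (EFin \o ((fun x => signal S x ^+ 2) \_ (@cube R p)))); last first.
  move=> x _ /=; rewrite !patchE; case: ifP => _.
    by rewrite powR_mulrn// real_normK ?num_real.
  by rewrite normr0 powR0// pnatr_eq0.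
rewrite -restrict_EFin -integral_mkcond -[X in (X `^ _)%E]fineK; last first.
  exact: integrable_fin_num intS.
rewrite [X in (X%:E `^ _)%E]ES poweR_EFin.
by rewrite powR12_sqrt ?mulr_ge0 ?sqr_ge0// sqrtrM ?sqr_ge0// sqrtr_sqr ger0_norm.
Qed.

Lemma drift_axis S t : (exists l, tnth t l = 0 :> R) -> drift S t = 0.
Proof.
move=> [l tl]; rewrite /drift big1// => j _; rewrite (bigD1 l)//=.
by rewrite tl primitive0 if_same mul0r mulr0.
Qed.

Lemma box_increment_drift S a b : box_increment (drift S) a b =
  \sum_(j in S) c * \prod_l (if l == j
    then primitive h (tnth b l) - primitive h (tnth a l) else tnth b l - tnth a l).
Proof.
pose g (j l : 'I_p) : R -> R := if l == j then primitive h else id.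
transitivity (box_increment (fun x : vec => \sum_(j in S) c * \prod_l g j l (tnth x l)) a b).
  congr box_increment; apply/funext => t; apply: eq_bigr => j _; congr (_ * _).
  by apply: eq_bigr => l _; rewrite /g; case: ifP.
rewrite box_increment_sum; apply: eq_bigr => j _.
rewrite (box_increment_prod (g j)); congr (_ * _).
by apply: eq_bigr => l _; rewrite /g; case: ifP.
Qed.

Context (N : nat) (G : nat -> R).
Context (G0 : G 0%N = 0) (GN : G N = 1) (G_lt : forall k, (k < N)%N -> G k < G k.+1).

Lemma grid_le k m : (k <= m <= N)%N -> G k <= G m.
Proof.
elim: m => [|m IH]; first by rewrite leqn0 => /andP[/eqP->].
move=> /andP[+ mN]; rewrite leq_eqVlt => /predU1P[->//|km].
by apply: le_trans (ltW (G_lt mN)); apply: IH; rewrite -ltnS km ltnW.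
Qed.

Definition lower_corner (i : {ffun 'I_p -> 'I_N}) : vec := grid_point G (fun l => i l).
Definition upper_corner (i : {ffun 'I_p -> 'I_N}) : vec := grid_point G (succ_cell i).

(** Averaging over cells is a projection of [L^2].  The off-diagonal terms vanish
since the increments of [primitive h] add up to the mean of [h], and the
diagonal ones are at most the squared norm of [h] by [primitive_sqr_le]. *)
Lemma drift_energy_le S T :
  \sum_(i : {ffun 'I_p -> 'I_N})
    box_increment (drift S) (lower_corner i) (upper_corner i) *
    box_increment (drift T) (lower_corner i) (upper_corner i) /
    box_volume (lower_corner i) (upper_corner i) <=
  c ^+ 2 * #|S :&: T|%:R.
Proof.
pose d (k : nat) := primitive h (G k.+1) - primitive h (G k).
pose w (k : nat) := G k.+1 - G k.
pose cross j m (l : 'I_p) (k : nat) :=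
  (if l == j then d k else w k) * (if l == m then d k else w k) / w k.
have w_gt0 (k : 'I_N) : 0 < w k by rewrite subr_gt0; exact: G_lt.
have sum_w : \sum_(k < N) w k = 1.
  by rewrite -(big_mkord xpredT w) telescope_sumr// GN G0 subr0.
have sum_d : \sum_(k < N) d k = 0.
  rewrite -(big_mkord xpredT d) (telescope_sumr (fun k => primitive h (G k)))//.
  rewrite GN G0 primitive0 subr0 -[RHS]h_mean /primitive.
  by apply: eq_Rintegral => x _; rewrite mulr1.
have sum_d2 : \sum_(k < N) d k ^+ 2 / w k <= 1.
  pose q u := primitive (fun y : R => h y ^+ 2) u.
  apply: (@le_trans _ _ (\sum_(k < N) (q (G k.+1) - q (G k)))).
    apply: ler_sum => k _; apply: primitive_sqr_le => //.
    - by have := @grid_le 0 k; rewrite G0; apply; rewrite leq0n ltnW.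
    - exact: G_lt.
    - by have := @grid_le k.+1 N; rewrite GN; apply; rewrite ltn_ord leqnn.
  rewrite -(big_mkord xpredT (fun k => q (G k.+1) - q (G k))).
  rewrite (telescope_sumr (fun k => q (G k)))// GN G0 /q primitive0 subr0.
  by rewrite -[leRHS]h_norm /primitive; under eq_Rintegral do rewrite expr2.
(* Increments of the drift are products over the axes, up to the sums over
   [S] and [T], so that the sum over cells factors. *)
have cell i : box_increment (drift S) (lower_corner i) (upper_corner i) *
    box_increment (drift T) (lower_corner i) (upper_corner i) /
    box_volume (lower_corner i) (upper_corner i) =
    c ^+ 2 * \sum_(j in S) \sum_(m in T) \prod_l cross j m l (i l).
  rewrite !box_increment_drift -!mulr_sumr mulrACA -expr2 -mulrA; congr (_ * _).
  rewrite mulr_suml mulr_suml; apply: eq_bigr => j _.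
  rewrite mulr_sumr mulr_suml; apply: eq_bigr => m _.
  rewrite -big_split -prodf_div; apply: eq_bigr => l _.
  by rewrite /= !tnth_mktuple.
under eq_bigr do rewrite cell.
rewrite -mulr_sumr; apply: ler_wpM2l; first exact: sqr_ge0.
rewrite exchange_big/=.
under eq_bigr => j _.
  rewrite exchange_big/=.
  under eq_bigr => m _ do rewrite -(bigA_distr_bigA (fun l (k : 'I_N) => cross j m l k)).
  over.
have offdiag j m : j != m -> \prod_l \sum_(k < N) cross j m l k = 0.
  move=> jm; rewrite (bigD1 j)//= (eq_bigr (fun k : 'I_N => d k)); last first.
    by move=> k _; rewrite /cross eqxx (negbTE jm) mulfK// gt_eqF.
  by rewrite sum_d mul0r.
have diag j : \prod_l \sum_(k < N) cross j j l k <= 1.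
  rewrite (bigD1 j)//= [X in _ * X]big1 => [|l lj]; last first.
    rewrite -[RHS]sum_w; apply: eq_bigr => k _.
    by rewrite /cross (negbTE lj) mulfK// gt_eqF.
  by rewrite mulr1 /cross eqxx; under eq_bigr do rewrite -expr2.
rewrite (bigID (mem T))/= [X in _ + X]big1 ?addr0 => [|j /andP[_ jT]]; last first.
  by rewrite big1// => m mT; apply: offdiag; apply: contraNneq jT => ->.
rewrite -sumr_const; under [leRHS]eq_bigl do rewrite inE.
apply: ler_sum => j /andP[_ jT]; rewrite (bigD1 j)//= [X in _ + X]big1 ?addr0//.
by move=> m /andP[_ mj]; apply: offdiag; rewrite eq_sym.
Qed.

End signal.

(** * The white noise model on a grid *)

Section path_space.
Context (R : realType) (p : nat).

Lemma measurable_to_path d (T : measurableType d) (f : T -> path_space R p) :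
  (forall t, cube t -> measurable_fun setT (fun w => f w t)) -> measurable_fun setT f.
Proof.
move=> mf; apply: (@measurability _ _ _ _ _ f (@path_cylinders R p)) => //.
move=> _ [_ [t [t01 [A mA ->]]] <-].
by apply: mf.
Qed.

End path_space.

Lemma measure_ae_eq d (T : measurableType d) (R : realType)
    (mu : {measure set T -> \bar R}) (A C : set T) : measurable A -> measurable C ->
  {ae mu, forall x, A x <-> C x} -> mu A = mu C.
Proof.
move=> mA mC AC; rewrite -[A]setIT -[C]setIT -!integral_indic//.
apply: ge0_ae_eq_integral => //.
- by apply/measurable_EFinP; exact: measurable_indic.
- by apply/measurable_EFinP; exact: measurable_indic.
apply: filterS AC => x AC _; rewrite !indicE (_ : (x \in A) = (x \in C))//.
by apply/idP/idP; rewrite !inE => /AC.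
Qed.

Section white_noise_on_grid.
Context (R : realType) (h : R -> R) (p n : nat) (c : R).
Context (h_L2 : L2unit h) (h_mean : L2unit_ip h (fun=> 1) = 0)
  (h_norm : L2unit_ip h h = 1) (n_gt0 : (0 < n)%N).
Context (d : measure_display) (Omega : measurableType d) (P : probability Omega R)
  (B : p.-tuple (measurableTypeR R) -> Omega -> R) (B_sheet : brownian_sheet P B).
Notation vec := (p.-tuple (measurableTypeR R)).
Implicit Types (S T : {set 'I_p}) (t : vec).

Definition observation S : Omega -> path_space R p := white_noise n B (signal h c S).

Lemma observationE S w t : cube t ->
  observation S w t = drift h c S t + (Num.sqrt n%:R)^-1 * B t w.
Proof. by move=> t01; rewrite /observation /white_noise Rintegral_signal. Qed.

Lemma measurable_observation S : measurable_fun setT (observation S).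
Proof.
apply: measurable_to_path => t t01.
apply: (eq_measurable_fun (fun w => drift h c S t + (Num.sqrt n%:R)^-1 * B t w)).
  by move=> w _; rewrite observationE.
apply: measurable_funD => //; apply: measurable_funM => //.
exact: (sheet_measurable B_sheet).
Qed.

Context (N : nat) (G : nat -> R).
Context (G0 : G 0%N = 0) (GN : G N = 1) (G_lt : forall k, (k < N)%N -> G k < G k.+1).
Notation cell := {ffun 'I_p -> 'I_N}.
Notation lo := (lower_corner G).
Notation hi := (upper_corner G).

Let G_le := grid_le G_lt.

Let G01 k : (k <= N)%N -> 0 <= G k <= 1.
Proof.
move=> kN; have := @G_le 0 k; have := @G_le k N.
by rewrite G0 GN leqnn kN => -> // ->.
Qed.

Lemma cube_grid_point (m : 'I_p -> nat) : (forall l, (m l <= N)%N) -> cube (grid_point G m).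
Proof. by move=> mN l; rewrite tnth_mktuple; exact: G01. Qed.

Lemma cell_is_box (i : cell) : is_box (lo i) (hi i).
Proof.
move=> l; rewrite !tnth_mktuple; have il := ltn_ord (i l); split; last 2 first.
- exact: G_lt.
- by have /andP[] := G01 il.
- by have /andP[] := G01 (ltnW il).
Qed.

Lemma cells_disjoint (i j : cell) : i != j -> box (lo i) (hi i) `&` box (lo j) (hi j) = set0.
Proof.
have sep (a b : cell) l (x : vec) : (a l < b l)%N -> box (lo a) (hi a) x ->
    box (lo b) (hi b) x -> False.
  move=> ab /(_ l) /andP[_ xa] /(_ l) /andP[+ _]; rewrite !tnth_mktuple in xa *.
  rewrite ltNge => /negP; apply; apply: le_trans xa _; apply: G_le.
  by rewrite ab ltnW.
move=> ij; apply/seteqP; split=> // x [xi xj].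
have [l il] : exists l, i l != j l.
  by apply/existsP; apply: contra_neqT ij => /existsPn H; apply/ffunP => l;
    apply/eqP; have := H l; rewrite negbK.
have [lt|lt|/val_inj/eqP eq] := ltngtP (i l) (j l).
- exact: sep lt xi xj.
- exact: sep lt xj xi.
- by rewrite eq in il.
Qed.

Definition cell_of (k : 'I_#|{: cell}|) : cell := enum_val k.
Definition cell_sd k := Num.sqrt (box_volume (lo (cell_of k)) (hi (cell_of k))).
(** Increments are scaled by [sqrt n], so that the noise has the law of the
Brownian sheet whatever [n] is. *)
Definition cell_mean S k :=
  Num.sqrt n%:R * box_increment (drift h c S) (lo (cell_of k)) (hi (cell_of k)).
Definition cell_obs S k w :=
  Num.sqrt n%:R * box_increment (observation S w) (lo (cell_of k)) (hi (cell_of k)).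

Lemma box_volume_gt0 (a b : vec) : is_box a b -> 0 < box_volume a b.
Proof. by move=> ab; apply: prodr_gt0 => l _; rewrite subr_gt0; case: (ab l). Qed.

Lemma eq_box_increment (F1 F2 : vec -> R) (a b : vec) : cube a -> cube b ->
  (forall t, cube t -> F1 t = F2 t) -> box_increment F1 a b = box_increment F2 a b.
Proof.
move=> a01 b01 F12; apply: eq_bigr => S _; congr (_ * _); apply: F12 => l.
by rewrite tnth_mktuple; case: ifP.
Qed.

Let n_neq0 : Num.sqrt (n%:R : R) != 0.
Proof. by rewrite gt_eqF// sqrtr_gt0 ltr0n. Qed.

Let cube_lo (i : cell) : cube (lo i).
Proof. by apply: cube_grid_point => l; exact: ltnW. Qed.

Let cube_hi (i : cell) : cube (hi i).
Proof. by apply: cube_grid_point => l; exact: ltn_ord. Qed.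

Lemma cell_obsE S k w : cell_obs S k w =
  box_increment (B ^~ w) (lo (cell_of k)) (hi (cell_of k)) + cell_mean S k.
Proof.
rewrite /cell_obs (eq_box_increment (F2 := fun t =>
  drift h c S t + (Num.sqrt n%:R)^-1 * B t w))//; last first.
  by move=> t t01; rewrite observationE.
by rewrite box_incrementD mulrDr mulrA divff// mul1r addrC.
Qed.

Lemma measurable_cell_obs S k : measurable_fun setT (cell_obs S k).
Proof.
apply: (eq_measurable_fun (fun w =>
  box_increment (B ^~ w) (lo (cell_of k)) (hi (cell_of k)) + cell_mean S k)).
  by move=> w _; rewrite cell_obsE.
apply: measurable_funD => //; apply: measurable_sum => J; apply: measurable_funM => //.
apply: (sheet_measurable B_sheet) => l; rewrite tnth_mktuple.
by case: ifP => _; [exact: cube_hi|exact: cube_lo].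
Qed.

Lemma cell_obs_law S (A : set (#|{: cell}|.-tuple (measurableTypeR R))) : measurable A ->
  P [set w | A [tuple cell_obs S k w | k < #|{: cell}|]] =
  gauss_prob cell_sd (cell_mean S) A.
Proof.
apply: law_gauss; first exact: measurable_cell_obs.
move=> D mD.
pose D' k := [set x : R | D k (x + cell_mean S k)].
have mD' k : measurable (D' k).
  have mshift : measurable_fun setT (fun x : R => x + cell_mean S k).
    exact: measurable_funD.
  by rewrite -[D' k]setTI; exact: mshift.
have shifted w k : D k (cell_obs S k w) =
    D' k (box_increment (B ^~ w) (lo (cell_of k)) (hi (cell_of k))).
  by rewrite /D' /= -cell_obsE.
have disj k l : k != l -> box (lo (cell_of k)) (hi (cell_of k)) `&`
    box (lo (cell_of l)) (hi (cell_of l)) = set0.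
  by move=> kl; apply: cells_disjoint; rewrite (inj_eq enum_val_inj).
rewrite (_ : [set w | _] = [set w | forall k, D' k
    (box_increment (B ^~ w) (lo (cell_of k)) (hi (cell_of k)))]); last first.
  by apply/seteqP; split=> w /= H k; have := H k; rewrite shifted.
rewrite (sheet_independent B_sheet (fun k => cell_is_box (cell_of k)) disj mD').
apply: eq_bigr => k _.
rewrite (sheet_gaussian B_sheet (cell_is_box _) (mD' k)) -/(cell_sd k).
rewrite -[cell_mean S k]add0r -normal_prob_shift ?add0r//.
by rewrite gt_eqF// sqrtr_gt0 box_volume_gt0//; exact: cell_is_box.
Qed.

(** A path whose values at grid points are the sums of the given increments over
the cells below them.  Off the grid the choice is immaterial, as long as it is
measurable. *)
Definition rebuild (x : #|{: cell}|.-tuple (measurableTypeR R)) : path_space R p :=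
  fun t => \sum_k (if [forall l, tnth (hi (cell_of k)) l <= tnth t l :> R]
    then (Num.sqrt n%:R)^-1 * tnth x k else 0).

Lemma measurable_rebuild : measurable_fun setT rebuild.
Proof.
apply: measurable_to_path => t _; apply: measurable_sum => k.
case: [forall l, _]; last exact: measurable_cst.
by apply: measurable_funM => //; exact: measurable_tnth.
Qed.

Lemma G_mono k m : (k <= N)%N -> (m <= N)%N -> (G k <= G m) = (k <= m)%N.
Proof.
move=> kN mN; have [km|mk] := leqP k m; first by rewrite G_le// km.
apply/negbTE; rewrite -ltNge; apply: lt_le_trans (G_lt (leq_trans mk kN)) _.
by apply: G_le; rewrite mk.
Qed.

Lemma rebuildE S w (m : 'I_p -> nat) : (forall l, (m l <= N)%N) ->
  (forall k : 'I_p -> nat, (forall l, (k l <= N)%N) -> (exists l, k l = 0%N) ->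
     B (grid_point G k) w = 0) ->
  rebuild [tuple cell_obs S k w | k < #|{: cell}|] (grid_point G m) =
  observation S w (grid_point G m).
Proof.
move=> mN B0; rewrite (grid_reconstruct (F := observation S w) mN); last first.
  move=> k kN k0; rewrite observationE; last exact: cube_grid_point.
  rewrite B0// mulr0 addr0; apply: drift_axis; case: k0 => l kl.
  by exists l; rewrite tnth_mktuple kl.
rewrite /rebuild -big_mkcond [RHS](reindex (@enum_val {: cell} predT))/=; last first.
  exact/onW_bij/enum_val_bij.
apply: eq_big => k.
  apply: eq_forallb => l; rewrite !tnth_mktuple G_mono//; exact: ltn_ord.
by move=> _; rewrite tnth_mktuple /cell_obs mulKf.
Qed.

Definition grid_determined (C : set (path_space R p)) :=
  forall y y' : path_space R p,
    (forall m : 'I_p -> nat, (forall l, (m l <= N)%N) ->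
       y (grid_point G m) = y' (grid_point G m)) -> C y -> C y'.

(** The sheet vanishes almost surely at each given point of the hyperplanes; here
the null set is common to the finitely many grid points. *)
Lemma sheet_axes_ae : {ae P, forall w, forall k : 'I_p -> nat,
  (forall l, (k l <= N)%N) -> (exists l, k l = 0%N) -> B (grid_point G k) w = 0}.
Proof.
have fin_ae : {ae P, forall w, forall v : {ffun 'I_p -> 'I_N.+1},
    (exists l, v l = 0%N :> nat) -> B (grid_point G (fun l => v l)) w = 0}.
  have : {ae P, forall w, forall v, v \in enum {: {ffun 'I_p -> 'I_N.+1}} ->
      (exists l, v l = 0%N :> nat) -> B (grid_point G (fun l => v l)) w = 0}.
    elim: (enum _) => [|v r IH]; first by apply: aeW.
    have vN l : (v l <= N)%N by rewrite -ltnS.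
    have v_ae : {ae P, forall w, (exists l, v l = 0%N :> nat) ->
        B (grid_point G (fun l => v l)) w = 0}.
      have [v0|nv0] := pselect (exists l, v l = 0%N :> nat); last exact: aeW.
      have := sheet_axes B_sheet (cube_grid_point vN).
      have ax : exists l, tnth (grid_point G (fun l => v l)) l = 0 :> R.
        by case: v0 => l vl; exists l; rewrite tnth_mktuple vl.
      by move=> /(_ ax); apply: filterS => w Bw _.
    apply: filterS2 v_ae IH => w Bv Br v'; rewrite in_cons => /predU1P[->//|].
    exact: Br.
  by apply: filterS => w H v; apply: H; rewrite mem_enum.
apply: filterS fin_ae => w H k kN [l kl].
have kN' l' : (k l' < N.+1)%N by rewrite ltnS.
have := H [ffun l => Ordinal (kN' l)].
rewrite (_ : grid_point G _ = grid_point G k); last first.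
  by apply: eq_mktuple => l'; rewrite ffunE.
by apply; exists l; rewrite ffunE.
Qed.

(** Almost surely the observed path and the one rebuilt from its increments agree
on the grid, hence belong to [C] together. *)
Lemma observation_grid_law S (C : set (path_space R p)) : measurable C ->
  grid_determined C ->
  P (observation S @^-1` C) = gauss_prob cell_sd (cell_mean S) (rebuild @^-1` C).
Proof.
move=> mC detC.
have mRC : measurable (rebuild @^-1` C).
  by rewrite -[X in measurable X]setTI; exact: measurable_rebuild.
have mOC : measurable (observation S @^-1` C).
  by rewrite -[X in measurable X]setTI; exact: measurable_observation.
rewrite -(cell_obs_law S mRC).
have mX : measurable_fun setT (fun w =>
    [tuple cell_obs S k w | k < #|{: cell}|] : _.-tuple (measurableTypeR R)).
  apply/measurable_fun_tnthP => k; apply: eq_measurable_fun (measurable_cell_obs S k) => w _.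
  by rewrite /= tnth_mktuple.
have mXC : measurable [set w | (rebuild @^-1` C) [tuple cell_obs S k w | k < #|{: cell}|]].
  by rewrite -[X in measurable X]setTI; exact: mX.
apply: measure_ae_eq => //.
apply: filterS sheet_axes_ae => w B0.
have agree m : (forall l, (m l <= N)%N) ->
    rebuild [tuple cell_obs S k w | k < #|{: cell}|] (grid_point G m) =
    observation S w (grid_point G m) by move=> mN; exact: rebuildE.
by split; apply: detC => m mN; rewrite agree.
Qed.
Lemma grid_mixture_bound (s : nat) (kappa eta : R) (C : set (path_space R p)) :
  (0 < s)%N -> (s <= p)%N -> 0 < kappa ->
  kappa * n%:R <= ln (1 + p%:R / s%:R ^+ 2) ->
  c ^+ 2 <= kappa -> 0 < eta -> c ^+ 2 <= kappa * ln (1 + 4 * eta ^+ 2) ->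
  measurable C -> grid_determined C ->
  fine (P (observation finset.set0 @^-1` C)) <=
    'C(p, s)%:R^-1 *
      \sum_(S : {set 'I_p} | #|S| == s) fine (P (observation S @^-1` C)) + eta.
Proof.
move=> s0 sp k0 n_le c_le1 eta0 c_le2 mC detC.
have mRC : measurable (rebuild @^-1` C).
  by rewrite -[X in measurable X]setTI; exact: measurable_rebuild.
pose D := [pred S : {set 'I_p} | #|S| == s].
have cardD : #|D| = 'C(p, s) by rewrite card_size_sets card_ord.
have mean0 : cell_mean finset.set0 = fun=> 0.
  by apply/funext => k; rewrite /cell_mean box_increment_drift big_set0 mulr0.
have sd_neq0 k : cell_sd k != 0.
  by rewrite gt_eqF// sqrtr_gt0 box_volume_gt0//; exact: cell_is_box.
have energy S T : \sum_k cell_mean S k * cell_mean T k / cell_sd k ^+ 2 <=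
    n%:R * c ^+ 2 * #|S :&: T|%:R.
  have := ler_wpM2l (ler0n R n)
    (drift_energy_le c h_L2 h_mean h_norm G0 GN G_lt S T).
  rewrite [leRHS]mulrA; apply: le_trans.
  rewrite mulr_sumr (reindex (@enum_val {: cell} predT))/=; last first.
    exact/onW_bij/enum_val_bij.
  rewrite le_eqVlt; apply/orP; left; apply/eqP; apply: eq_bigr => k _.
  rewrite /cell_sd sqr_sqrtr; last by rewrite ltW// box_volume_gt0//; exact: cell_is_box.
  by rewrite /cell_mean mulrACA -expr2 sqr_sqrtr// !mulrA.
have chi : \sum_(S in D) \sum_(T in D)
    expR (\sum_k cell_mean S k * cell_mean T k / cell_sd k ^+ 2) <=
    #|D|%:R ^+ 2 * (1 + 4 * eta ^+ 2).
  apply: (@le_trans _ _ (\sum_(S in D) 'C(p, s)%:R * (1 + 4 * eta ^+ 2))).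
    apply: ler_sum => S /eqP Ss.
    have := @sum_exp_overlap_le R 'I_p S n s kappa c eta; rewrite !card_ord.
    move=> /(_ s0 sp Ss k0 n_le c_le1 c_le2); apply: le_trans.
    by apply: ler_sum => T _; rewrite ler_expR energy.
  by rewrite sumr_const cardD -[leLHS]mulr_natl mulrA -expr2.
rewrite observation_grid_law// mean0.
under eq_bigr do rewrite observation_grid_law//.
have D0 : (0 < #|D|)%N by rewrite cardD bin_gt0.
by have := gauss_mixture_le sd_neq0 D0 eta0 chi mRC; rewrite cardD.
Qed.

End white_noise_on_grid.

(** * From grids to the whole path *)

(** The nodes [0] and [1] are added: the first to reach the coordinate
hyperplanes, the second for the cells to cover the whole interval, on which [h]
has mean zero. *)
Lemma grid_of_seq (R : realType) (g : seq R) : {in g, forall x, 0 <= x <= 1} ->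
  exists N (G : nat -> R), [/\ G 0%N = 0, G N = 1,
    forall k, (k < N)%N -> G k < G k.+1 &
    {in g, forall x, exists2 k, (k <= N)%N & G k = x}].
Proof.
move=> g01; pose s := sort <=%R (undup (0 :: 1 :: g)).
have mem_s x : (x \in s) = [|| x == 0, x == 1 | x \in g].
  by rewrite mem_sort mem_undup !inE.
have s01 x : x \in s -> 0 <= x <= 1.
  by rewrite mem_s => /or3P[/eqP->|/eqP->|/g01//]; rewrite lexx ler01.
have sorted_s : sorted <%R s by rewrite sort_lt_sorted undup_uniq.
have s_gt0 : (0 < size s)%N.
  by have : (0 : R) \in s; [rewrite mem_s eqxx|case: s {mem_s s01 sorted_s}].
have lt_nth k m : (m < size s)%N -> (k < m)%N -> nth 0 s k < nth 0 s m.
  by move=> ms km; apply: (sorted_ltn_nth lt_trans) => //; rewrite inE (ltn_trans km).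
have find x : x \in s -> exists2 k, (k <= (size s).-1)%N & nth 0 s k = x.
  move=> xs; exists (index x s); last exact: nth_index.
  by rewrite -ltnS prednK// index_mem.
exists (size s).-1, (nth 0 s); split.
- have [|k _ k0] := find 0; first by rewrite mem_s eqxx.
  case: k k0 => // k k0.
  have [ks|ks] := ltnP k.+1 (size s).
    have := lt_nth 0%N k.+1 ks isT; rewrite k0 ltNge.
    by have /andP[->] := s01 _ (mem_nth 0 s_gt0).
  have [j js j0] : exists2 j, (j < size s)%N & nth 0 s j = 0.
    by exists (index 0 s); rewrite ?index_mem ?nth_index// mem_s eqxx.
  case: j js j0 => // j js j0; have := lt_nth 0%N j.+1 js isT; rewrite j0 ltNge.
  by have /andP[->] := s01 _ (mem_nth 0 s_gt0).
- have [|k + k1] := find 1; first by rewrite mem_s eqxx orbT.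
  rewrite leq_eqVlt => /predU1P[<-//|klt].
  have last_lt : ((size s).-1 < size s)%N by rewrite prednK.
  have := lt_nth _ _ last_lt klt; rewrite k1 ltNge.
  by have /andP[_ ->] := s01 _ (mem_nth 0 last_lt).
- by move=> k kN; apply: lt_nth => //; rewrite -ltnS prednK in kN *.
- by move=> x xg; apply: find; rewrite mem_s xg !orbT.
Qed.

Section cylinders.
Context (R : realType) (p : nat).
Notation path := (path_space R p).

(** Dependence on the values at the points with all coordinates in a finite set,
rather than at finitely many arbitrary points: unions of such sets are again of
the same form, and they are turned directly into grids. *)
Definition finitely_determined (C : set path) := exists2 g : seq R,
  {in g, forall x, 0 <= x <= 1} &
  forall y y' : path, (forall t, (forall l, tnth t l \in g) -> y t = y' t) -> C y -> C y'.

Definition cylinder_ring : set (set path) :=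
  [set C | measurable C /\ finitely_determined C].

Lemma setring_cylinder_ring : setring cylinder_ring.
Proof.
have merge C1 C2 : finitely_determined C1 -> finitely_determined C2 ->
    exists2 g : seq R, {in g, forall x, 0 <= x <= 1} & forall y y' : path,
    (forall t, (forall l, tnth t l \in g) -> y t = y' t) -> (C1 y <-> C1 y') /\ (C2 y <-> C2 y').
  move=> [g1 g101 det1] [g2 g201 det2]; exists (g1 ++ g2).
    by move=> x; rewrite mem_cat => /orP[/g101|/g201].
  move=> y y' yy'.
  have yy1 t : (forall l, tnth t l \in g1) -> y t = y' t.
    by move=> tg; apply: yy' => l; rewrite mem_cat tg.
  have yy2 t : (forall l, tnth t l \in g2) -> y t = y' t.
    by move=> tg; apply: yy' => l; rewrite mem_cat tg orbT.
  by split; split; [apply: det1|apply: det1|apply: det2|apply: det2] => t tg;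
    rewrite ?(yy1 _ tg) ?(yy2 _ tg).
split.
- by split; [exact: measurable0|exists [::]].
- move=> C1 C2 [m1 d1] [m2 d2]; split; first exact: measurableU.
  have [g g01 H] := merge _ _ d1 d2; exists g => // y y' /H[E1 E2].
  by move=> [/E1|/E2]; [left|right].
- move=> C1 C2 [m1 d1] [m2 d2]; split; first exact: measurableD.
  have [g g01 H] := merge _ _ d1 d2; exists g => // y y' /H[E1 E2].
  by move=> [/E1 ? nC2]; split=> // /E2.
Qed.

Lemma measurable_sub_cylinder_ring (C : set path) : measurable C -> <<sr cylinder_ring>> C.
Proof.
have [sr0 srD srU] := smallest_sigma_ring cylinder_ring.
suff : <<s @path_cylinders R p>> `<=` <<sr cylinder_ring>> by apply.
apply: smallest_sub.
  split=> // A srA; apply: srD => //; apply: sub_g_sigma_ring.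
  by split; [exact: measurableT|exists [::]].
move=> _ [t [t01 [A mA ->]]]; apply: sub_g_sigma_ring; split.
  by apply: sub_sigma_algebra; exists t; split => //; exists A.
exists (tval t).
  by move=> x /tnthP[l ->]; exact: t01.
by move=> y y' yy'; rewrite /= yy'// => l; exact: mem_tnth.
Qed.

End cylinders.

Lemma fine_cvg_nondecreasing d d' (T : measurableType d) (T' : measurableType d')
    (R : realType) (P : probability T R) (f : T -> T') (F : (set T')^nat) :
  measurable_fun setT f -> (forall i, measurable (F i)) -> nondecreasing_seq F ->
  (fun i => fine (P (f @^-1` F i))) @ \oo --> fine (P (f @^-1` (\bigcup_i F i))).
Proof.
move=> mf mF ndF.
have mfF i : measurable (f @^-1` F i) by rewrite -[X in measurable X]setTI; exact: mf.
rewrite preimage_bigcup; apply: fine_cvg; rewrite fineK ?fin_num_measure//; last first.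
  exact: bigcup_measurable.
apply: nondecreasing_cvg_mu => //; first exact: bigcup_measurable.
by move=> i j ij; apply/subsetPset; apply: preimage_subset; exact/subsetPset/ndF.
Qed.

Lemma fine_cvg_nonincreasing d d' (T : measurableType d) (T' : measurableType d')
    (R : realType) (P : probability T R) (f : T -> T') (F : (set T')^nat) :
  measurable_fun setT f -> (forall i, measurable (F i)) -> nonincreasing_seq F ->
  (fun i => fine (P (f @^-1` F i))) @ \oo --> fine (P (f @^-1` (\bigcap_i F i))).
Proof.
move=> mf mF niF.
have mfF i : measurable (f @^-1` F i) by rewrite -[X in measurable X]setTI; exact: mf.
rewrite preimage_bigcap; apply: fine_cvg; rewrite fineK ?fin_num_measure//; last first.
  exact: bigcap_measurable.
apply: nonincreasing_cvg_mu => //; last 2 first.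
- exact: bigcap_measurable.
- by move=> i j ij; apply/subsetPset; apply: preimage_subset; exact/subsetPset/niF.
by rewrite -ge0_fin_numE// fin_num_measure.
Qed.

Section mixture_bound.
Context (R : realType) (h : R -> R) (p n s : nat) (c kappa eta : R).
Context (h_L2 : L2unit h) (h_mean : L2unit_ip h (fun=> 1) = 0)
  (h_norm : L2unit_ip h h = 1) (n_gt0 : (0 < n)%N).
Context (d : measure_display) (Omega : measurableType d) (P : probability Omega R)
  (B : p.-tuple (measurableTypeR R) -> Omega -> R) (B_sheet : brownian_sheet P B).
Context (s_gt0 : (0 < s)%N) (s_le_p : (s <= p)%N) (kappa_gt0 : 0 < kappa)
  (log_ge : kappa * n%:R <= ln (1 + p%:R / s%:R ^+ 2)) (c_le : c ^+ 2 <= kappa)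
  (eta_gt0 : 0 < eta) (c_le_ln : c ^+ 2 <= kappa * ln (1 + 4 * eta ^+ 2)).

Notation obs := (observation h n c B).

(** The inequality is between measures of [C], hence preserved by monotone limits
of [C]; by the monotone class theorem it suffices to have it on
[cylinder_ring]. *)
Lemma mixture_bound (C : set (path_space R p)) : measurable C ->
  fine (P (obs finset.set0 @^-1` C)) <=
    'C(p, s)%:R^-1 *
      \sum_(S : {set 'I_p} | #|S| == s) fine (P (obs S @^-1` C)) + eta.
Proof.
pose bound (r : {set 'I_p} -> R) := 'C(p, s)%:R^-1 *
  \sum_(S : {set 'I_p} | #|S| == s) r S + eta - r finset.set0.
pose prob (C : set (path_space R p)) (S : {set 'I_p}) := fine (P (obs S @^-1` C)).
have mobs S : measurable_fun setT (obs S).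
  by apply: (measurable_observation _ _ _ B_sheet).
have limit (E : (set (path_space R p))^nat) E' :
    (forall S, (fun i => prob (E i) S) @ \oo --> prob E' S) ->
    (forall i, 0 <= bound (prob (E i))) -> 0 <= bound (prob E').
  move=> EE' E_ge0; apply: (@cvg_ge_lim _ (fun i => bound (prob (E i)))).
    apply: cvgB; last exact: EE'.
    apply: cvgD; last exact: cvg_cst.
    apply: cvgM; first exact: cvg_cst.
    rewrite -big_filter; under eq_fun do rewrite -big_filter.
    by apply: cvg_sum_seq => S _; exact: EE'.
  exact: nearW.
pose M := [set C | measurable C /\ 0 <= bound (prob C)].
suff sub : <<sr @cylinder_ring R p>> `<=` M.
  by move=> /measurable_sub_cylinder_ring /sub[_]; rewrite /bound subr_ge0.
apply: monotone_setring_sub_g_sigma_ring.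
- split=> F mono MF; have mF i : measurable (F i) by have [] := MF i.
    split; first exact: bigcup_measurable.
    apply: (limit F) => [S|i]; last by have [] := MF i.
    exact: fine_cvg_nondecreasing.
  split; first exact: bigcap_measurable.
  apply: (limit F) => [S|i]; last by have [] := MF i.
  exact: fine_cvg_nonincreasing.
- exact: setring_cylinder_ring.
move=> {}C [mC [g g01 detC]]; split=> //.
have [N [G [G0 GN G_lt gG]]] := grid_of_seq g01.
rewrite /bound subr_ge0; apply: (grid_mixture_bound h_L2 h_mean h_norm n_gt0 B_sheet G0 GN G_lt
  s_gt0 s_le_p kappa_gt0 log_ge c_le eta_gt0 c_le_ln mC).
move=> y y' yy'; apply: detC => t tg.
have /choice[m mP] (l : 'I_p) : exists k, (k <= N)%N /\ G k = tnth t l.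
  by have [k kN Gk] := gG _ (tg l); exists k.
have -> : t = grid_point G m.
  by apply: eq_from_tnth => l; rewrite tnth_mktuple (mP l).2.
by apply: yy' => l; exact: (mP l).1.
Qed.

End mixture_bound.

(** * The lower bound *)

Theorem proposition1 (R : realType)
  (H : set (R -> R)) (ip : (R -> R) -> (R -> R) -> R)
  (K : R -> R -> R) (lambda : nat -> R) (phi : nat -> R -> R)
  (K0 : R -> R -> R) (mu : nat -> R) (psi : nat -> R -> R)
  (H_L2 : H `<=` @L2unit R)
  (H_rkhs : is_rkhs H ip K)
  (K_mercer : mercer_expansion K lambda phi)
  (H0_rkhs : is_rkhs (centered H) ip K0)
  (K0_mercer : mercer_expansion K0 mu psi)
  (mu1 : mu 0%N = 1)
  (p n s : nat) (n_gt0 : (0 < n)%N) (s_ge1 : (1 <= s)%N) (s_le_p : (s <= p)%N)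
  (d : measure_display) (Omega : measurableType d) (P : probability Omega R)
  (B : p.-tuple (measurableTypeR R) -> Omega -> R)
  (B_sheet : brownian_sheet P B)
  (kappa : R) (kappa_gt0 : 0 < kappa)
  (log_ge : kappa * n%:R <= ln (1 + p%:R / s%:R ^+ 2))
  (eta : R) (eta_gt0 : 0 < eta) (eta_lt1 : eta < 1)
  (c : R) (c_gt0 : 0 < c)
  (c_lt : c < Num.min 1 (Num.min (Num.sqrt kappa)
                           (Num.sqrt (kappa * ln (1 + 4 * eta ^+ 2))))) :
  ((1 - eta)%:E <=
   ereal_inf
     [set (white_noise_law n P B (fun=> 0%R) [set y | test y != false]
           + ereal_sup
               [set white_noise_law n P B f [set y | test y != true]
               | f in [set f | sparse_additive (centered H) ip s f /\
                               (c * Num.sqrt s%:R)%:E <= cube_L2norm f]])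
     | test in [set test : path_space R p -> bool
               | measurable_fun setT test]])%E.
Proof.
have [h [Hh h_psi h_ball]] := top_eigenfunction_in_unit_ball H0_rkhs K0_mercer mu1.
have h_L2 : L2unit h by apply: H_L2; exact: Hh.1.
have h_mean : L2unit_ip h (fun=> 1) = 0 by exact: Hh.2.
have h_norm : L2unit_ip h h = 1.
  rewrite -[RHS](_ : L2unit_ip (psi 0%N) (psi 0%N) = _); last first.
    by rewrite (mercer_orthonormal K0_mercer) eqxx.
  by apply: eq_Rintegral => x; rewrite inE => x01; rewrite h_psi.
move: c_lt; rewrite !lt_min => /and3P[c_lt1 c_lt_kappa c_lt_ln].
have c_sqr (a : R) : 0 <= a -> c < Num.sqrt a -> c ^+ 2 <= a.
  move=> a0 ca; rewrite -[leRHS]sqr_sqrtr// ler_sqr ?nnegrE ?sqrtr_ge0 ?ltW//.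
have c_le_kappa := c_sqr _ (ltW kappa_gt0) c_lt_kappa.
have c_le_ln : c ^+ 2 <= kappa * ln (1 + 4 * eta ^+ 2).
  apply: c_sqr c_lt_ln; apply: mulr_ge0; first exact: ltW.
  by rewrite ln_ge0// lerDl mulr_ge0// sqr_ge0.
pose obs := observation h n c B.
have mobs S : measurable_fun setT (obs S).
  by have := measurable_observation n c h_L2 B_sheet S.
have null_signal : (fun=> 0) = signal h c (finset.set0 : {set 'I_p}).
  by apply/funext => x; rewrite /signal big_set0.
apply: le_ereal_inf_tmp => _ [test mtest <-].
pose C : set (path_space R p) := [set y | test y != true].
have mC : measurable C.
  rewrite (_ : C = test @^-1` [set false]); last first.
    by apply/seteqP; split=> y; rewrite /C /=; case: (test y).
  by rewrite -[X in measurable X]setTI; exact: mtest.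
have mobsC S : measurable (obs S @^-1` C).
  by rewrite -[X in measurable X]setTI; exact: mobs.
set alt := ereal_sup _.
(* Every signal of the prior is an admissible alternative. *)
have le_alt (S : {set 'I_p}) : #|S| = s -> (P (obs S @^-1` C) <= alt)%E.
  move=> Ss; apply: ereal_sup_ubound; exists (signal h c S) => //; split; last first.
    by rewrite cube_L2norm_signal ?Ss// ltW.
  exists S; first by rewrite Ss.
  exists (fun=> fun x => c * h x) => // j _; split; first exact: rkhs_memZ H0_rkhs _ _ Hh.
  have Hch := rkhs_memZ H0_rkhs c Hh.
  rewrite /rkhs_norm -[leRHS]sqrtr1 ler_sqrt//.
  rewrite (rkhs_ipZl H0_rkhs)// (rkhs_ip_sym H0_rkhs Hh Hch) (rkhs_ipZl H0_rkhs)//.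
  have := rkhs_ip_ge0 H0_rkhs Hh; move: h_ball c_gt0 c_lt1; nra.
have -> : white_noise_law n P B (fun=> 0%R) [set y | test y != false] =
    (1 - fine (P (obs finset.set0 @^-1` C)))%:E.
  rewrite null_signal EFinB fineK ?fin_num_measure// -probability_setC//.
  congr (P _); apply/seteqP; split=> w; rewrite /C /=.
    by case: (test _).
  by case: (test _).
have := mixture_bound h_L2 h_mean h_norm n_gt0 B_sheet s_ge1 s_le_p kappa_gt0 log_ge
  c_le_kappa eta_gt0 c_le_ln mC.
rewrite -/obs; set avg := _ * _ => null_le.
have avg_le : (avg%:E <= alt)%E.
  have card_pos : (0 < 'C(p, s))%N by rewrite bin_gt0.
  have [S0 S0s] : exists S0 : {set 'I_p}, #|S0| = s.
    have : (0 < #|[pred S : {set 'I_p} | #|S| == s]|)%N by rewrite card_size_sets card_ord.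
    by move=> /card_gt0P[S0]; rewrite inE => /eqP; exists S0.
  case: alt le_alt => [r||] le_r; last 2 first.
  - by rewrite leey.
  - have := le_r _ S0s; rewrite leNgt => /negP; case.
    by rewrite (lt_le_trans _ (measure_ge0 P _))// ltNyr.
  rewrite lee_fin /avg mulrC ler_pdivrMr ?ltr0n//.
  rewrite mulr_natr -[p in 'C(p, s)]card_ord -card_size_sets -sumr_const; apply: ler_sum => S /eqP Ss.
  by rewrite -lee_fin fineK ?fin_num_measure//; exact: le_r.
apply: le_trans (leeD2l _ avg_le).
by rewrite -EFinD lee_fin; lra.
Qed.
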